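(* Let $J \subseteq \mathbb{R}$ be a non-empty open interval, and for a continuous function $f$ on a closed interval $K$ write $\|f\|_{K,\infty} = \sup_{x \in K} |f(x)|$. Let $(\psi_n)_{n \in \mathbb{N}}$ be a sequence in $(0,1/10)$ satisfying: (A1) $\sup_{n \in \mathbb{N}} \sum_{\ell=1}^\infty \frac{\psi_{2^\ell n}\,\ell^2}{\psi_n} < \infty$; (A2) the sequence $(\psi_n/n)_{n \in \mathbb{N}}$ is non-increasing; (A3) there exists $c>1$ such that $\psi_n < c\,\psi_{2n}$ for all $n \in \mathbb{N}$; (A4) $\sum_{p \text{ prime}} \psi_p = \infty$. Let $(\varphi_n : \overline{J} \to \mathbb{R})_{n \in \mathbb{N}}$ be a sequence of $C^1$ functions satisfying: (B1) $\sup_{n \in \mathbb{N}} \|\varphi_n\|_{\overline{J},\infty} < \infty$; (B2) the sequence $(\|\varphi_n'\|_{\overline{J},\infty})_{n \in \mathbb{N}}$ is eventually non-increasing; (B3) $\displaystyle \lim_{N \to \infty} \frac{\sum_{p \le N,\ p \text{ prime}} \max\big(\psi_p, \|\varphi_p'\|_{\overline{J},\infty}\big)(\log p)^2}{\big(\sum_{p \le N,\ p \text{ prime}} \psi_p\big)^2} = 0$; (B4) $\displaystyle \lim_{n \to \infty} \frac{\|\varphi_n'\|_{\overline{J},\infty}}{n \psi_n} = 0$. Let $(\rho_n : \overline{J} \to \mathbb{R})_{n \in \mathbb{N}}$ be a sequence of $C^1$ functions such that for every proper subinterval $J' \subseteq J$: (C1) the sequence $\Big( \big( \rho_n\big( \tfrac{m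 - \varphi_n(m/n)}{n}\big) \big)_{m \in nJ' \cap \mathbb{Z}} \Big)_{n \in \mathbb{N}}$ equidistributes modulo 1; (C2) $\displaystyle \lim_{n \to \infty} \frac{\psi_n \|\rho_n'\|_{\overline{J'},\infty}}{n} = 0$. Let $I \subseteq [0,1)$ be a non-empty interval. Then for Lebesgue-almost every $\theta \in J$, there are infinitely many $n \in \mathbb{N}$ such that \[ \|\theta n + \varphi_n(\theta)\| \le \psi_n \quad \text{and} \quad \{\rho_n(\theta)\} \in I. \]
   Context: $\|x\|$ denotes the distance from $x \in \mathbb{R}$ to the nearest integer and $\{x\}$ the fractional part of $x$. $nJ' = \{nj : j \in J'\}$. Sums indexed by $p$ are over primes. Definition: for each $n \in \mathbb{N}$ let $S_n \subseteq \mathbb{Z}$ be finite and $F_n : S_n \to \mathbb{R}$; the sequence $(F_n)_{n\in\mathbb{N}}$ (written $((F_n(m))_{m \in S_n})_{n}$) equidistributes modulo 1 if for every interval $I \subseteq [0,1)$, $\lim_{n \to \infty} \frac{1}{|S_n|}\,|\{m \in S_n : \{F_n(m)\} \in I\}| = \lambda(I)$, where $\lambda$ is Lebesgue measure. *)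

(* Defs.v *)
From HB Require Import structures.
From mathcomp Require Import all_boot all_order all_algebra finmap.
From mathcomp Require Import all_classical all_reals all_analysis.

Set Implicit Arguments.
Unset Strict Implicit.
Unset Printing Implicit Defensive.

Import Order.TTheory GRing.Theory Num.Theory.
Import numFieldNormedType.Exports.

Local Open Scope classical_set_scope.
Local Open Scope ring_scope.

Section Defs.
Context {R : realType}.
Implicit Types (A K : set R) (f : R -> R) (x : R).

(* The library's [is_interval] is order-convexity; it also holds of the empty
   set and of singletons. *)
Definition nondegenerate_interval A : Prop :=
  is_interval A /\ exists x y, [/\ A x, A y & x < y].

Definition dist_int x : R := inf [set `|x - k%:~R| | k in [set: int]].

Definition frac_part x : R := x - (Num.floor x)%:~R.

(* Functions on a closed interval [K] are total functions of which only the
   values on [K] are used. [deriv_in K f x] is the derivative of the restriction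
   of [f] to [K], hence one-sided at an endpoint of [K]; [x^'] is the filter of
   punctured neighbourhoods of [x]. *)
Definition diff_quot f x : R -> R := fun y => (f y - f x) / (y - x).

Definition deriv_in K f x : R := lim (diff_quot f x @ within K x^').

Definition C1_on K f : Prop :=
  (forall x, K x -> cvg (diff_quot f x @ within K x^')) /\
  {within K, continuous (deriv_in K f)}.

(* Extended-real valued, because [K] may be unbounded. *)
Definition supnorm K f : \bar R := ereal_sup [set `|f x|%:E | x in K].

Definition dilate_int (n : nat) A : set int :=
  [set m : int | exists2 j, A j & m%:~R = n%:R * j].

(* Sequences are indexed by the positive integers: the index 0 is a dummy. *)
Definition equidistributes_mod1 (S : nat -> set int) (F : nat -> int -> R) : Prop :=
  (forall n, (0 < n)%N -> finite_set (S n)) /\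
  forall A, is_interval A -> A `<=` `[0, 1[ ->
    (fun n => (#|` fset_set [set m | S n m /\ A (frac_part (F n m))]|%:R
               / #|` fset_set (S n)|%:R)%:E)
      @ \oo --> lebesgue_measure A.

End Defs.

(* Main.v *)
(** Only primes n = p are used.  Near an interval [c, d] of length at most 1
    the admissible theta contain, for each p, the disjoint arcs of radius
    psi p / (4 p) around the points (m - phi p (m / p)) / p for which rho p
    lands well inside I; by equidistribution there are at least
    kap (d - c) p / 2 of them.  A second moment argument shows that the arcs
    with k <= p < N cover a proportion of [c, d] bounded below independently of
    [c, d] and k, which forces the exceptional set to be null (cover it by
    intervals with almost optimal total length).

    For the second moment one counts, for primes p < q, the pairs (m, m') whose
    arcs meet.  On pieces of [c, d] where phi p and phi q vary by at most psi p,
    such pairs give points (m, q m - p m') of the lattice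
    { (a, h) : p | q a - h } in a box.  The number of lattice points in a box is
    of the order of its normalised area, unless the lattice has a very short
    vector (al, r); for fixed (al, r) this confines q to few classes modulo p,
    so that on average over q these exceptions contribute
    O(max(psi p, |phi p'|) log p), which is negligible by (B3). *)
Require Import Defs.
From HB Require Import structures.
From mathcomp Require Import all_boot all_order all_algebra finmap.
From mathcomp Require Import all_classical all_reals all_analysis.
From mathcomp Require Import measurable_realfun ring lra zify.

Import Order.TTheory GRing.Theory Num.Theory.
Import numFieldNormedType.Exports.

Local Open Scope classical_set_scope.
Local Open Scope ring_scope.

Set Implicit Arguments.
Unset Strict Implicit.
Unset Printing Implicit Defensive.

(** The variation of [phi] is the obstacle. If the functions were constant, all q m - p m' of
    meeting arcs would lie in one window, and coprimality of p and q would control how often a value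
    recurs. Freezing [phi p] up to [psi p] requires about D / psi p + 1 pieces, where D is a
    Lipschitz constant of [phi p], and every piece costs O(1) pairs beyond its area. The number of
    pieces times [psi p] is comparable to max(psi p, D), which is how this maximum enters (B3).
    Primality is used twice: p does not divide q, so a short lattice vector has two nonzero
    coordinates, and al is invertible modulo p, so a pair (al, r) determines q modulo p up to the
    sign of r. Averaging over q then leads to the series of psi (j p) / j, which (A1) and (A2) bound
    by a multiple of [psi p]; the logarithm is the harmonic sum over r. By (A4) the diagonal of the
    second moment, of order sum psi, is dominated by (sum psi)^2. *)

(** * Points of a congruence lattice in a box *)

Lemma int_offset_lt (R : realType) (x : int) (a A : R) :
  a <= x%:~R <= a + A ->
  0 <= x - Num.ceil a < (Num.floor A + 1).
Proof.
move=> /andP[h1 h2].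
have c1 : Num.ceil a <= x by rewrite ceil_le_int.
rewrite subr_ge0 c1 /= ltzD1 floor_ge_int intrB.
have := ceil_ge a; lra.
Qed.

Lemma size_le_grid (R : realType) (T : eqType) (s : seq T) (f g : T -> int)
    (a A b B : R) :
  uniq s -> 0 <= A -> 0 <= B ->
  {in s &, forall x y, f x = f y -> g x = g y -> x = y} ->
  {in s, forall x, a <= (f x)%:~R <= a + A} ->
  {in s, forall x, b <= (g x)%:~R <= b + B} ->
  (size s)%:R <= (A + 1) * (B + 1).
Proof.
move=> us A0 B0 inj fA gB.
have hA := floor_le A; have hB := floor_le B.
have A1 : 0 <= Num.floor A by rewrite floor_ge0.
have B1 : 0 <= Num.floor B by rewrite floor_ge0.
pose K1 := absz (Num.floor A + 1); pose K2 := absz (Num.floor B + 1).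
pose F x := (absz (f x - Num.ceil a), absz (g x - Num.ceil b)).
have HF x : x \in s -> F x \in [seq (i, j) | i <- iota 0 K1, j <- iota 0 K2].
  move=> xs; apply/allpairsP; exists (F x); split => //=; rewrite mem_iota add0n.
    by have := int_offset_lt (fA _ xs); rewrite /F /K1; lia.
  by have := int_offset_lt (gB _ xs); rewrite /F /K2; lia.
have uF : uniq (map F s).
  rewrite map_inj_in_uniq // => x y xs ys [e1 e2]; apply: inj => //.
    have := int_offset_lt (fA _ xs); have := int_offset_lt (fA _ ys); lia.
  have := int_offset_lt (gB _ xs); have := int_offset_lt (gB _ ys); lia.
have sz : (size s <= K1 * K2)%N.
  rewrite -(size_map F s) -[(K1 * K2)%N](_ : size [seq (i, j) | i <- iota 0 K1, j <- iota 0 K2] = _).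
    by apply: uniq_leq_size => // _ /mapP[x xs ->]; apply: HF.
  by rewrite size_allpairs !size_iota.
have e1 : K1%:R = (Num.floor A)%:~R + 1 :> R.
  by rewrite /K1 -[1 in RHS]/(1%:~R) -intrD natr_absz ger0_norm //; lia.
have e2 : K2%:R = (Num.floor B)%:~R + 1 :> R.
  by rewrite /K2 -[1 in RHS]/(1%:~R) -intrD natr_absz ger0_norm //; lia.
apply: le_trans (_ : (K1 * K2)%:R <= _); first by rewrite ler_nat.
rewrite natrM e1 e2; apply: ler_pM; rewrite ?lerD2r //.
  by rewrite addr_ge0 // ler0z.
by rewrite addr_ge0 // ler0z.
Qed.

Lemma size_le_window (R : realType) (s : seq int) (a A : R) :
  uniq s -> 0 <= A -> {in s, forall x, a <= x%:~R <= a + A} ->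
  (size s)%:R <= A + 1.
Proof.
move=> us A0 sA.
rewrite (_ : A + 1 = (A + 1) * (0 + 1)); last by rewrite add0r mulr1.
apply: (@size_le_grid R _ s id (fun=> 0) a A 0 0) => // x _.
by rewrite addr0 lexx.
Qed.

Lemma seq_argmin (R : realType) (T : eqType) (s : seq T) (f : T -> R) :
  s != [::] -> exists2 x, x \in s & {in s, forall y, f x <= f y}.
Proof.
elim: s => // a s IH _; case: (eqVneq s [::]) => [->|/IH[x xs hx]].
  by exists a; rewrite ?mem_head // => y; rewrite inE => /eqP ->.
case: (leP (f a) (f x)) => h.
  exists a; first exact: mem_head.
  by move=> y; rewrite inE => /orP[/eqP -> //|ys]; exact: le_trans h (hx _ ys).
exists x; first by rewrite inE xs orbT.
by move=> y; rewrite inE => /orP[/eqP ->|ys]; [exact: ltW|exact: hx].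
Qed.

(** The determinant against v = (v1, v2) is a multiple of p, and the quotient [f] numbers the lines
    parallel to v; [g] cuts each line into stretches of width |v1|. Two points with equal [f] and
    [g] would differ by a multiple of v of factor less than 1, against the separation hypothesis.
    That hypothesis says that no difference is shorter than v in the norm max(|X| / A, |Y| / L),
    whose value at v comes from the first coordinate. *)
Lemma size_le_lines (R : realType) (T : eqType) (s : seq T) (X Y : T -> int)
    (p : nat) (v1 v2 : int) (a0 h0 A L : R) :
  uniq s -> (0 < p)%N -> 0 < A -> 0 < L -> v1 != 0 ->
  A * `|v2|%:~R <= L * `|v1|%:~R ->
  {in s, forall x, `|(X x)%:~R - a0| <= A} ->
  {in s, forall x, `|(Y x)%:~R - h0| <= L} ->
  {in s, forall x, (p %| X x * v2 - Y x * v1)%Z} ->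
  {in s &, forall x y, x != y -> `|v1| <= `|X x - X y| \/
     L * `|v1|%:~R <= A * `|Y x - Y y|%:~R} ->
  (size s)%:R <= (4 * L * `|v1|%:~R / p%:R + 1) * (2 * A / `|v1|%:~R + 1 + 1).
Proof.
move=> us p0 A0 L0 v0 Av XA YL dvd sep.
have pR : 0 < p%:R :> R by rewrite ltr0n.
have w0 : 0 < `|v1| by rewrite normr_gt0.
have wR : 0 < `|v1|%:~R :> R by rewrite ltr0z.
pose f x := ((X x * v2 - Y x * v1) %/ p)%Z.
pose g x := (X x %/ `|v1|)%Z.
have fE x : x \in s -> (f x)%:~R * p%:R = (X x)%:~R * v2%:~R - (Y x)%:~R * v1%:~R :> R.
  move=> xs; rewrite -[p%:R]/(p%:Z%:~R) -intrM /f divzK ?dvd //.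
  by rewrite intrB !intrM.
apply: (@size_le_grid R _ s f g
  ((a0 * v2%:~R - h0 * v1%:~R - 2 * L * `|v1|%:~R) / p%:R) _
  ((a0 - A) / `|v1|%:~R - 1)) => //.
- by rewrite divr_ge0 // ?mulr_ge0 // ltW.
- by rewrite addr_ge0 // divr_ge0 // ?mulr_ge0 // ltW.
- move=> x y xs ys fxy gxy; apply/eqP; apply/negPn/negP => nxy.
  have lin : (X x - X y) * v2 = (Y x - Y y) * v1.
    have := divzK (dvd _ xs); have := divzK (dvd _ ys).
    rewrite -/(f x) -/(f y) fxy => -> h.
    by rewrite !mulrBl; clear -h; lia.
  have small : `|X x - X y| < `|v1|.
    have := divz_eq (X x) `|v1|; have := divz_eq (X y) `|v1|.
    rewrite -/(g x) -/(g y) gxy.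
    have := @ltz_mod (X x) `|v1|; have := @ltz_mod (X y) `|v1|.
    have := @modz_ge0 (X x) `|v1|; have := @modz_ge0 (X y) `|v1|.
    rewrite !normr_id !gt_eqF // => /(_ isT) a1 /(_ isT) a2 /(_ isT) a3 /(_ isT) a4.
    move=> a5 a6; set U := g y * `|v1| in a5 a6 *.
    by clear -a1 a2 a3 a4 a5 a6; lia.
  case: (sep _ _ xs ys nxy) => [|h]; first by rewrite leNgt small.
  have linR : `|X x - X y|%:~R * `|v2|%:~R = `|Y x - Y y|%:~R * `|v1|%:~R :> R.
    by rewrite -!intrM -!normrM lin.
  have smallR : `|X x - X y|%:~R < `|v1|%:~R :> R by rewrite ltr_int.
  have x0 : 0 <= `|X x - X y|%:~R :> R by rewrite ler0z.
  have : L * `|v1|%:~R * `|v1|%:~R <= L * `|v1|%:~R * `|X x - X y|%:~R.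
    have h1 := ler_wpM2r (ltW wR) h.
    apply: (le_trans h1); have h2 := ler_wpM2l x0 Av.
    have h3 := congr1 (fun z => A * z) linR; lra.
  by rewrite ler_pM2l ?mulr_gt0 // leNgt smallR.
- move=> x xs; have := XA _ xs; have := YL _ xs => hY hX.
  have d1 : `|((X x)%:~R - a0) * v2%:~R - ((Y x)%:~R - h0) * v1%:~R| <= 2 * L * `|v1|%:~R.
    apply: le_trans (ler_normB _ _) _; rewrite !normrM.
    have h1 : `|(X x)%:~R - a0| * `|v2%:~R| <= A * `|v2%:~R| by apply: ler_wpM2r.
    have h2 : `|(Y x)%:~R - h0| * `|v1%:~R| <= L * `|v1%:~R| by apply: ler_wpM2r.
    rewrite -?intr_norm in h1 h2 *; lra.
  move: d1; rewrite ler_norml => /andP[d1 d2].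
  rewrite ler_pdivrMr // fE // -mulrDl ler_pdivlMr // fE //.
  by apply/andP; split; lra.
- move=> x xs; have := XA _ xs; rewrite ler_norml => /andP[h1 h2].
  have e := divz_eq (X x) `|v1|.
  have m1 := @ltz_mod (X x) `|v1|; have m2 := @modz_ge0 (X x) `|v1|.
  rewrite -/(g x) in e; rewrite !normr_id gt_eqF // in m1 m2.
  have eR : (X x)%:~R = (g x)%:~R * `|v1|%:~R + (X x %% `|v1|)%Z%:~R :> R.
    by rewrite -intrM -intrD -e.
  have k1 : (X x %% `|v1|)%Z%:~R < `|v1|%:~R :> R by rewrite ltr_int m1.
  have k2 : 0 <= (X x %% `|v1|)%Z%:~R :> R by rewrite ler0z m2.
  rewrite -[X in _ && X](@ler_pM2r _ (`|v1|%:~R : R)) //.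
  rewrite -[X in X && _](@ler_pM2r _ (`|v1|%:~R : R)) //.
  have w1 : `|v1|%:~R != 0 :> R by rewrite gt_eqF.
  rewrite !(mulrDl, mulNr, mul1r) !(mulfVK w1).
  by apply/andP; split; lra.
Qed.

(** Points spaced by the shortest difference v lie on lines parallel to v. The number of lines times
    the number of points per line is of the order of the normalised area W plus 1 / |v|. The second
    alternative is the case where 1 / |v| dominates, and (al, r) is then v up to signs. *)
Lemma lattice_count (R : realType) (p q : nat) (s : seq (int * int))
    (a0 h0 A L : R) :
  (0 < p)%N -> coprime p q -> uniq s -> 1 <= A -> A <= p%:R -> 0 < L ->
  {in s, forall x, `|x.1%:~R - a0| <= A} ->
  {in s, forall x, `|x.2%:~R - h0| <= L} ->
  {in s, forall x, (p %| q%:Z * x.1 - x.2)%Z} ->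
  (size s)%:R <= 6 + 30 * (A * L / p%:R) \/
  exists al r : nat, [/\ (0 < al < p)%N, (0 < r < p)%N, al%:R * L < p%:R,
    (p %| q%:Z * al%:Z - r%:Z)%Z \/ (p %| q%:Z * al%:Z + r%:Z)%Z
    & (size s)%:R <= 30 * (L / r%:R)].
Proof.
move=> p0 cpq us A1 Ap L0 s1 s2 dvd.
have A0 : 0 < A by apply: lt_le_trans A1.
have pR : 0 < p%:R :> R by rewrite ltr0n.
pose W := A * L / p%:R.
have W0 : 0 < W by rewrite divr_gt0 // mulr_gt0.
pose t := [seq u <- [seq (x, y) | x <- s, y <- s] | u.1 != u.2].
case: (eqVneq t [::]) => [t0|tN0].
  left; have : (size s <= 1)%N.
    case: s us {s1 s2 dvd} @t t0 => [|x [|y s]] //= /andP[xNs _].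
    have : x != y by apply: contraNneq xNs => ->; rewrite mem_head.
    by rewrite eqxx /= => ->.
  rewrite -(ler_nat R) => h; apply: (le_trans h); rewrite -/W; lra.
(* In this norm the box becomes a square. The vector v chosen below is the shortest difference
   between two points of [s], which is all that the separation hypothesis of [size_le_lines] asks
   for. *)
pose nu (v : int * int) : R := Num.max (`|v.1|%:~R / A) (`|v.2|%:~R / L).
pose d (u : (int * int) * (int * int)) := (u.1.1 - u.2.1, u.1.2 - u.2.2).
have [[x y] xyt minxy] := seq_argmin (nu \o d) tN0.
move: xyt; rewrite mem_filter /= => /andP[nxy /allpairsP[[x' y'] /= [xs ys [ex ey]]]].
subst x' y'.
set v := d (x, y) in minxy *; set la := nu v.
have minv z z' : z \in s -> z' \in s -> z != z' -> la <= nu (d (z, z')).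
  move=> zs zs' nz; apply: (minxy (z, z')); rewrite mem_filter /= nz /=.
  by apply/allpairsP; exists (z, z').
have v0 : v != (0, 0).
  apply: contra nxy => /eqP[h1 h2]; case: x y {minxy xs ys v la minv} h1 h2 => [x1 x2] [y1 y2] /= h1 h2.
  by apply/eqP; congr pair; apply/eqP; rewrite -subr_eq0; apply/eqP.
have vdvd : (p %| q%:Z * v.1 - v.2)%Z.
  have := dvd _ xs; have := dvd _ ys.
  rewrite (_ : q%:Z * v.1 - v.2 = (q%:Z * x.1 - x.2) - (q%:Z * y.1 - y.2)).
    by move=> h1 h2; apply: rpredB.
  by rewrite /v /=; ring.
have la1 : `|v.1|%:~R <= la * A.
  by rewrite -ler_pdivrMr // /la /nu le_max lexx.
have la2 : `|v.2|%:~R <= la * L.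
  by rewrite -ler_pdivrMr // /la /nu le_max lexx orbT.
have laP : 0 < la.
  rewrite /la /nu lt_max; case: (eqVneq v.1 0) => [v10|v1N].
    apply/orP; right; rewrite divr_gt0 // ltr0z normr_gt0.
    by apply: contra v0 => /eqP v20; rewrite [v]surjective_pairing v10 v20.
  by apply/orP; left; rewrite divr_gt0 // ltr0z normr_gt0.
have lale2 : la <= 2.
  rewrite /la /nu ge_max !ler_pdivrMr // /v /=; apply/andP; split.
    have := s1 _ xs; have := s1 _ ys; rewrite !ler_norml intr_norm ler_norml intrB; lra.
  have := s2 _ xs; have := s2 _ ys; rewrite !ler_norml intr_norm ler_norml intrB; lra.
have dvd1 : {in s, forall z : int * int, (p %| z.1 * v.2 - z.2 * v.1)%Z}.
  move=> z zs; rewrite (_ : _ - _ = (q%:Z * z.1 - z.2) * v.1 - (q%:Z * v.1 - v.2) * z.1).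
    by apply: rpredB; apply: dvdz_mulr => //; exact: dvd.
  by ring.
have dvd2 : {in s, forall z : int * int, (p %| z.2 * v.1 - z.1 * v.2)%Z}.
  by move=> z zs; rewrite -opprB rpredN; exact: dvd1.
(* [size_le_lines] applies along v, with the two coordinates exchanged if the second one attains the
   norm; [la <= 2] absorbs the lower terms. *)
have N1 : (size s)%:R <= 6 / la + 24 * W.
  have [h|h] := leP (`|v.2|%:~R / L) (`|v.1|%:~R / A).
    have e : `|v.1|%:~R = la * A by rewrite /la /nu max_l // divfK ?gt_eqF.
    have v1N : v.1 != 0 by rewrite -normr_gt0 -(ltr0z R) e mulr_gt0.
    have := @size_le_lines R _ s fst snd p v.1 v.2 a0 h0 A L us p0 A0 L0 v1N.
    have c1 : A * `|v.2|%:~R <= L * `|v.1|%:~R.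
      by move: h; rewrite ler_pdivrMr // mulrAC ler_pdivlMr // mulrC [X in _ <= X]mulrC.
    move=> /(_ c1 s1 s2 dvd1); rewrite e.
    have -> : 2 * A / (la * A) = 2 / la.
      by rewrite -mulf_div divff ?gt_eqF // mulr1.
    have -> : 4 * L * (la * A) / p%:R = 4 * W * la by rewrite /W; field; rewrite gt_eqF.
    move=> H; apply: (le_trans (H _)).
      move=> z z' zs zs' nz; have := minv _ _ zs zs' nz.
      rewrite /nu le_max => /orP[] hh; [left|right].
        by move: hh; rewrite -(ler_int R) e ler_pdivlMr.
      move: hh; rewrite ler_pdivlMr // => hh.
      by have := ler_wpM2l (ltW A0) hh; rewrite /=; lra.
    set i := la^-1.
    have ii : la * i = 1 by rewrite /i divff ?gt_eqF.
    have i2 : 1 <= 2 * i by rewrite /i ler_pdivlMr ?mul1r.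
    have -> : (4 * W * la + 1) * (2 * i + 1 + 1) = 8 * W * (la * i) + 8 * W * la + 2 * i + 2 by ring.
    rewrite ii; have := ler_wpM2l (ltW W0) lale2; lra.
  have e : `|v.2|%:~R = la * L by rewrite /la /nu max_r ?ltW // divfK ?gt_eqF.
  have v2N : v.2 != 0 by rewrite -normr_gt0 -(ltr0z R) e mulr_gt0.
  have := @size_le_lines R _ s snd fst p v.2 v.1 h0 a0 L A us p0 L0 A0 v2N.
  have c1 : L * `|v.1|%:~R <= A * `|v.2|%:~R.
    by move: (ltW h); rewrite ler_pdivrMr // mulrAC ler_pdivlMr // mulrC [X in _ <= X]mulrC.
  move=> /(_ c1 s2 s1 dvd2); rewrite e.
  have -> : 2 * L / (la * L) = 2 / la.
    by rewrite -mulf_div divff ?gt_eqF // mulr1.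
  have -> : 4 * A * (la * L) / p%:R = 4 * W * la by rewrite /W; field; rewrite gt_eqF.
  move=> H; apply: (le_trans (H _)).
    move=> z z' zs zs' nz; have := minv _ _ zs zs' nz.
    rewrite /nu le_max => /orP[] hh; [right|left].
      move: hh; rewrite ler_pdivlMr // => hh.
      by have := ler_wpM2l (ltW L0) hh; rewrite /=; lra.
    by move: hh; rewrite -(ler_int R) e ler_pdivlMr.
  set i := la^-1.
  have ii : la * i = 1 by rewrite /i divff ?gt_eqF.
  have i2 : 1 <= 2 * i by rewrite /i ler_pdivlMr ?mul1r.
  have -> : (4 * W * la + 1) * (2 * i + 1 + 1) = 8 * W * (la * i) + 8 * W * la + 2 * i + 2 by ring.
  rewrite ii; have := ler_wpM2l (ltW W0) lale2; lra.
(* If 1 / la exceeds 1 + W, then la W < 1. This forces |v.1| L < p and |v.2| A < p, so neither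
   coordinate can be a nonzero multiple of p. *)
have [h|h] := leP la^-1 (1 + W); first by left; rewrite -/W; lra.
right.
set i := la^-1 in h N1.
have i1 : 1 < i by lra.
have iW : W < i by lra.
have lai : la * i = 1 by rewrite /i divff ?gt_eqF.
have la_lt1 : la < 1 by rewrite -lai ltr_pMr.
have laW : la * W < 1 by rewrite -lai ltr_pM2l.
have v1A : `|v.1|%:~R < A.
  by apply: le_lt_trans la1 _; rewrite gtr_pMl.
have v1L : `|v.1|%:~R * L < p%:R.
  apply: le_lt_trans (ler_wpM2r (ltW L0) la1) _.
  have -> : la * A * L = la * W * p%:R by rewrite /W; field; rewrite gt_eqF.
  by rewrite gtr_pMl.
have v2p : `|v.2|%:~R < p%:R :> R.
  have h2 : `|v.2|%:~R * A < p%:R.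
    apply: le_lt_trans (ler_wpM2r (ltW A0) la2) _.
    have -> : la * L * A = la * W * p%:R by rewrite /W; field; rewrite gt_eqF.
    by rewrite gtr_pMl.
  apply: le_lt_trans h2; rewrite ler_peMr // ler0z //.
have v1p : `|v.1|%:~R < p%:R :> R by apply: lt_le_trans v1A Ap.
have dv0 (z : int) : `|z|%:~R < p%:R :> R -> (p %| z)%Z -> z = 0.
  rewrite -natr_absz ltr_nat dvdzE /= => hz hd.
  case: (posnP (absz z)) => z0; first by apply/eqP; rewrite -absz_eq0 z0.
  by move: (leq_ltn_trans (dvdn_leq z0 hd) hz); rewrite ltnn.
have v1N : v.1 != 0.
  apply: contra v0 => /eqP v10; move: vdvd; rewrite v10 mulr0 sub0r rpredN => /(dv0 _ v2p) v20.
  by rewrite [v]surjective_pairing v10 v20.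
have v2N : v.2 != 0.
  apply: contra v1N => /eqP v20; move: vdvd; rewrite v20 subr0 => hd.
  apply/eqP/dv0 => //; move: hd; rewrite Gauss_dvdzr //.
exists (absz v.1), (absz v.2).
rewrite !absz_gt0 v1N v2N /=.
split.
- by rewrite -(ltr_nat R) natr_absz.
- by rewrite -(ltr_nat R) natr_absz.
- by rewrite natr_absz.
- have [a1|a1] := ltP v.1 0; have [a2|a2] := ltP v.2 0.
  + left; rewrite !abszE !ltr0_norm // -rpredN.
    by rewrite mulrN !opprK opprD opprK.
  + right; rewrite !abszE ltr0_norm // ger0_norm // -rpredN.
    by rewrite mulrN opprD opprK.
  + right; rewrite !abszE ger0_norm // ltr0_norm //.
  + by left; rewrite !abszE !ger0_norm.
- apply: le_trans (_ : 30 * i <= _); first lra.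
  rewrite ler_wpM2l // natr_absz /i ler_pdivlMr ?ltr0z ?normr_gt0 //.
  by rewrite mulrC ler_pdivrMr // mulrC.
Qed.

Lemma size_le_fibers (R : realType) (T : eqType) (s : seq T) (key : T -> nat)
    (K : nat) (C : R) :
  {in s, forall x, (key x < K)%N} ->
  (forall i, (i < K)%N -> (size [seq x <- s | key x == i])%:R <= C) ->
  (size s)%:R <= K%:R * C.
Proof.
move=> sK hC.
have -> : size s = (\sum_(i < K) size [seq x <- s | key x == i])%N.
  elim: s sK {hC} => [|x s IH] sK /=; first by rewrite big1.
  rewrite IH; last by move=> y ys; apply: sK; rewrite inE ys orbT.
  have xK : (key x < K)%N by apply: sK; rewrite mem_head.
  rewrite -add1n -[1%N](_ : (\sum_(i < K) (key x == i))%N = _)%N.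
    rewrite -big_split /=; apply: eq_bigr => i _.
    by case: eqP => _ /=; rewrite ?add1n ?add0n.
  rewrite (bigD1 (Ordinal xK)) //= eqxx big1 ?addn0 // => i.
  by rewrite -val_eqE /= eq_sym => /negPf ->.
rewrite natr_sum; apply: le_trans (ler_sum (G := fun=> C) _ _) _.
  by move=> i _; apply: hC.
by rewrite sumr_const card_ord mulr_natl.
Qed.

(** * Pairs of meeting arcs for two primes *)

(** Total weight of the short vectors that [lattice_count] can return for L = 4 q e. Summing over
    all of them, instead of selecting one, allows the sum over q to be exchanged with those over al
    and r. *)
Definition resonance (R : realType) (e : R) (p q : nat) : R :=
  \sum_(1 <= r < p) \sum_(1 <= al < p | (al%:R * (4 * q%:R * e) < p%:R) &&
     ((p %| q%:Z * al%:Z - r%:Z)%Z || (p %| q%:Z * al%:Z + r%:Z)%Z)) r%:R^-1.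

Lemma resonance_ge (R : realType) (e : R) (p q al r : nat) :
  (0 < al < p)%N -> (0 < r < p)%N -> al%:R * (4 * q%:R * e) < p%:R ->
  (p %| q%:Z * al%:Z - r%:Z)%Z \/ (p %| q%:Z * al%:Z + r%:Z)%Z ->
  r%:R^-1 <= resonance e p q.
Proof.
move=> alp rp hL /orP hd; rewrite /resonance.
under eq_bigr do rewrite big_mkcond /=.
rewrite (bigD1_seq r) ?mem_index_iota ?iota_uniq //=.
rewrite (bigD1_seq al) ?mem_index_iota ?iota_uniq //= hL hd /=.
rewrite -!addrA lerDl addr_ge0 //; apply: sumr_ge0 => i _.
  by case: ifP; rewrite ?invr_ge0.
by apply: sumr_ge0 => j _; case: ifP; rewrite ?invr_ge0.
Qed.

Lemma resonance_ge0 (R : realType) (e : R) (p q : nat) : 0 <= resonance e p q.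
Proof. by do 2![apply: sumr_ge0 => ? _]; rewrite invr_ge0. Qed.

(* The interval [c, c + b] is cut into M pieces on which f and g are constant
   up to e, so that on each piece q m - p m' lies in a window of radius 4 q e. *)
Lemma pair_count (R : realType) (p q M : nat) (s : seq (int * int))
    (f g : R -> R) (S : set R) (c b D B e : R) :
  (0 < p)%N -> (p < q)%N -> coprime p q -> uniq s -> (0 < M)%N ->
  0 < e -> 0 < b <= 1 -> M%:R <= b * p%:R -> 0 <= D ->
  D * b <= M%:R * e -> D * B <= e * p%:R ->
  (forall x, c <= x <= c + b -> S x) ->
  (forall x y, S x -> S y -> `|f x - f y| <= D * `|x - y|) ->
  (forall x y, S x -> S y -> `|g x - g y| <= D * `|x - y|) ->
  {in s, forall x, [/\ c <= x.1%:~R / p%:R <= c + b, S (x.2%:~R / q%:R),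
     `|x.2%:~R / q%:R - x.1%:~R / p%:R| <= B / p%:R &
     `|q%:R * x.1%:~R - p%:R * x.2%:~R
       - (q%:R * f (x.1%:~R / p%:R) - p%:R * g (x.2%:~R / q%:R))| <= q%:R * e]} ->
  (size s)%:R <= 12 * M%:R + 240 * b * (q%:R * e)
                 + 240 * M%:R * (q%:R * e) * resonance e p q.
Proof.
move=> p0 pq cpq us M0 e0 /andP[b0 b1] Mb D0 Db DB SI Lf Lg hs.
have pR : 0 < p%:R :> R by rewrite ltr0n.
have q0 : (0 < q)%N by apply: ltn_trans pq.
have qR : 0 < q%:R :> R by rewrite ltr0n.
have pqR : p%:R <= q%:R :> R by rewrite ler_nat ltnW.
have MR : 0 < M%:R :> R by rewrite ltr0n.
have M1 : 1 <= M%:R :> R by rewrite ler1n.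
pose dl := b / M%:R.
have dl0 : 0 < dl by rewrite divr_gt0.
have Mdl : M%:R * dl = b by rewrite /dl mulrC divfK ?gt_eqF.
have Ddl : D * dl <= e by rewrite /dl mulrA ler_pdivrMr // [e * _]mulrC.
have qed0 : 0 <= q%:R * e * dl by rewrite !mulr_ge0 // ltW.
pose key (x : int * int) := absz (Num.floor ((x.1%:~R / p%:R - c) / dl)).
have keyP x : x \in s -> c + (key x)%:R * dl <= x.1%:~R / p%:R < c + (key x)%:R * dl + dl.
  move=> /hs[/andP[h1 _] _ _ _].
  have f0 : 0 <= (x.1%:~R / p%:R - c) / dl by rewrite divr_ge0 ?(ltW dl0) // subr_ge0.
  rewrite /key natr_absz ger0_norm ?floor_ge0 //.
  have := floor_le ((x.1%:~R / p%:R - c) / dl).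
  have := floorD1_gt ((x.1%:~R / p%:R - c) / dl).
  rewrite ltr_pdivrMr // ler_pdivlMr // intrD mulrDl mul1r => h2 h3; apply/andP; split; lra.
(* The right endpoint c + b has key M, hence M + 1 classes. *)
have keyM x : x \in s -> (key x < M.+1)%N.
  move=> xs; have [/andP[_ h1] _ _ _] := hs _ xs; have /andP[h2 _] := keyP _ xs.
  rewrite ltnS -(ler_nat R) -(ler_pM2r dl0) Mdl; lra.
(* Of the radius, q e comes from the closeness hypothesis, q e from replacing f by its value at the
   left end of the piece, and 2 q e from doing the same with g, whose argument may stray by a
   further B / p. *)
pose L := 4 * q%:R * e; pose A := p%:R * dl.
have L0 : 0 < L by rewrite !mulr_gt0.
have A1 : 1 <= A by rewrite /A /dl mulrA ler_pdivlMr // mul1r mulrC.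
have Ap : A <= p%:R.
  rewrite /A ger_pMr // /dl ler_pdivrMr // mul1r; lra.
have key_fiber i : (i < M.+1)%N -> (size [seq x <- s | key x == i])%:R <=
    6 + 30 * (4 * q%:R * e * dl) + 30 * (L * resonance e p q).
  move=> iM; set si := [seq x <- s | _].
  have RX := resonance_ge0 e p q.
  pose x0 := c + i%:R * dl.
  have Sx0 : S x0.
    have iMR : i%:R <= M%:R :> R by rewrite ler_nat -ltnS.
    have h1 := ler_wpM2r (ltW dl0) iMR.
    have h2 : 0 <= i%:R * dl by rewrite mulr_ge0 // ltW.
    by apply: SI; rewrite /x0; apply/andP; split; lra.
  pose h (x : int * int) := (x.1, q%:Z * x.1 - p%:Z * x.2).
  have inj_h : injective h.
    move=> [x1 x2] [y1 y2] [-> /addrI/oppr_inj/mulfI -> //].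
    by rewrite -lt0n.
  pose t := map h si.
  have ut : uniq t.
    by rewrite map_inj_uniq // filter_uniq.
  have t1 : {in t, forall x, `|x.1%:~R - p%:R * x0| <= A}.
    move=> _ /mapP[x + ->]; rewrite mem_filter => /andP[/eqP ki xs] /=.
    have := keyP _ xs; rewrite ki -/x0.
    rewrite ler_pdivlMr // ltr_pdivrMr // /A => /andP[h1 h2].
    rewrite ger0_norm; lra.
  have t2 : {in t, forall x, `|x.2%:~R - (q%:R * f x0 - p%:R * g x0)| <= L}.
    move=> _ /mapP[x + ->]; rewrite mem_filter => /andP[/eqP ki xs] /=.
    have := keyP _ xs; rewrite ki -/x0 => /andP[h1 h2].
    have [h3 Sx2 h4 h5] := hs _ xs; have Sx1 := SI _ h3.
    have F1 := Lf _ _ Sx1 Sx0; have G1 := Lg _ _ Sx2 Sx0.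
    set u := x.1%:~R / p%:R in h1 h2 h3 h4 h5 Sx1 F1 *.
    set w := x.2%:~R / q%:R in Sx2 h4 h5 G1 *.
    have ux0 : `|u - x0| <= dl by rewrite ger0_norm; lra.
    have wx0 : `|w - x0| <= dl + B / p%:R.
      rewrite (_ : w - x0 = (u - x0) + (w - u)); last ring.
      exact: le_trans (ler_normD _ _) (lerD ux0 h4).
    have F2 : `|f u - f x0| <= e.
      by apply: (le_trans F1); apply: le_trans Ddl; exact: ler_wpM2l.
    have G2 : `|g w - g x0| <= 2 * e.
      apply: (le_trans G1); apply: le_trans (ler_wpM2l D0 wx0) _.
      have : D * (B / p%:R) <= e by rewrite mulrA ler_pdivrMr.
      lra.
    have F3 : `|q%:R * (f u - f x0)| <= q%:R * e.
      by rewrite normrM gtr0_norm // ler_pM2l.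
    have G3 : `|p%:R * (g w - g x0)| <= q%:R * (2 * e).
      by rewrite normrM gtr0_norm // ler_pM // ?ltW.
    rewrite intrB !intrM /L.
    move: h5 F3 G3; rewrite -![p%:Z%:~R]/(p%:R) -![q%:Z%:~R]/(q%:R) !ler_norml; lra.
  have t3 : {in t, forall x, (p %| q%:Z * x.1 - x.2)%Z}.
    move=> _ /mapP[x _ ->] /=.
    by rewrite opprB addrC subrK dvdz_mulr // dvdzz.
  have [|] := lattice_count p0 cpq ut A1 Ap L0 t1 t2 t3.
  - rewrite size_map => hh; apply: le_trans hh _.
    have -> : A * L / p%:R = 4 * q%:R * e * dl by rewrite /A /L; field; rewrite gt_eqF.
    have := mulr_ge0 (ltW L0) RX; lra.
  - move=> [al [r [al0 r0 alL hd]]]; rewrite size_map => hh; apply: le_trans hh _.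
    have := resonance_ge al0 r0 alL hd => hr.
    have h1 : L / r%:R <= L * resonance e p q by rewrite ler_pM2l.
    have := qed0; lra.
apply: le_trans (size_le_fibers keyM key_fiber) _.
have RX := resonance_ge0 e p q.
(* This doubling turns the constants 6 and 120 of one piece into 12 and 240. *)
have k1 : M.+1%:R <= 2 * M%:R :> R by rewrite -natr1; lra.
apply: le_trans (ler_wpM2r _ k1) _.
  have := mulr_ge0 (ltW L0) RX; have := qed0; lra.
have e2 : b * (q%:R * e) = M%:R * (q%:R * e * dl) by rewrite -Mdl; ring.
rewrite -mulrA -[240 * b * _]mulrA e2 /L; lra.
Qed.

(** * Averages over q in blocks of length p *)

Lemma sum_blocks (R : realType) (F : nat -> R) (p K : nat) :
  \sum_(p <= q < K.+1 * p) F q =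
  \sum_(1 <= j < K.+1) \sum_(j * p <= q < j.+1 * p) F q.
Proof.
elim: K => [|K IH]; first by rewrite mul1n !big_geq.
rewrite big_nat_recr //= -IH -big_cat_nat //=; first exact: leq_pmull.
by rewrite leq_mul2r leqnSn orbT.
Qed.

(** Cauchy condensation: for 2^l <= j < 2^(l+1), monotonicity of psi n / n gives psi (j p) / j <=
    psi (2^l p) / 2^l, so the whole dyadic block contributes at most psi (2^l p). *)
Lemma condensation (R : realType) (psi : nat -> R) (C : R) (p N : nat) :
  (forall n, (0 < n)%N -> 0 < psi n) ->
  (forall m n, (0 < m)%N -> (m <= n)%N -> psi n / n%:R <= psi m / m%:R) ->
  (forall n m, (0 < n)%N -> \sum_(1 <= l < m) psi (2 ^ l * n)%N <= C * psi n) ->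
  (0 < p)%N -> \sum_(1 <= j < N) psi (j * p)%N / j%:R <= (1 + C) * psi p.
Proof.
move=> psi0 A2 A1 p0.
have dyadic m : \sum_(1 <= j < 2 ^ m) psi (j * p)%N / j%:R <=
    \sum_(0 <= l < m) psi (2 ^ l * p)%N.
  elim: m => [|m IH]; first by rewrite expn0 !big_geq.
  have m0 : (0 < 2 ^ m)%N by rewrite expn_gt0.
  rewrite big_nat_recr //= (big_cat_nat (n := (2 ^ m)%N)) //=; last by rewrite leq_exp2l.
  apply: lerD => //.
  have -> : psi (2 ^ m * p)%N = \sum_(2 ^ m <= j < 2 ^ m.+1) psi (2 ^ m * p)%N / (2 ^ m)%:R.
    rewrite sumr_const_nat expnS mul2n -addnn addnK -[RHS]mulr_natr divfK ?pnatr_eq0 -?lt0n //.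
  rewrite big_nat_cond [leRHS]big_nat_cond; apply: ler_sum => j /andP[/andP[hj _] _].
  have j0 : (0 < j)%N by apply: leq_trans hj.
  have := A2 (2 ^ m * p)%N (j * p)%N; rewrite muln_gt0 m0 p0 leq_mul2r hj orbT.
  move=> /(_ isT isT); rewrite !natrM !invfM !mulrA ler_pM2r //.
  by rewrite invr_gt0 ltr0n.
apply: le_trans (_ : \sum_(1 <= j < 2 ^ N) psi (j * p)%N / j%:R <= _).
  case: N => [|N]; first by rewrite !big_geq.
  rewrite [leRHS](big_cat_nat (n := N.+1)) //=; last exact/ltnW/ltn_expl.
  rewrite lerDl sumr_ge0 // => j _; case: j => [|j]; first by rewrite invr0 mulr0.
  by rewrite divr_ge0 // ltW // psi0 // muln_gt0.
apply: le_trans (dyadic N) _.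
case: N => [|N].
  have := A1 p 0%N p0; rewrite !big_geq // mulrDl; have := psi0 _ p0; lra.
rewrite big_nat_recl // mul1n mulrDl mul1r lerD2l.
have := A1 p N.+1 p0; rewrite big_add1 /=; apply.
Qed.

Lemma card_small_multiples (R : realType) (y : R) (p : nat) : 0 < y ->
  \sum_(1 <= al < p | al%:R * y < 1) 1 <= y^-1.
Proof.
move=> y0; elim: p => [|p IH]; first by rewrite big_geq // invr_ge0 ltW.
case: (posnP p) => [->|p0]; first by rewrite big_geq // invr_ge0 ltW.
rewrite big_mkcond big_nat_recr //= -big_mkcond /=.
case: ifPn => [hp|_]; last by rewrite addr0.
apply: le_trans (_ : \sum_(1 <= al < p.+1) 1 <= _).
  rewrite big_nat_recr //= lerD2r big_mkcond; apply: ler_sum => i _.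
  by case: ifP.
rewrite sumr_const_nat subSS subn0 -(ler_pM2r y0) mulVf ?gt_eqF //.
exact: ltW.
Qed.

(** Since al is invertible modulo p, the congruence fixes q modulo p, and the block consists of p
    consecutive integers. *)
Lemma unique_in_block (p j al : nat) (c : int) (q q' : nat) :
  prime p -> (0 < al < p)%N -> (j * p <= q < j.+1 * p)%N ->
  (j * p <= q' < j.+1 * p)%N ->
  (p %| q%:Z * al%:Z + c)%Z -> (p %| q'%:Z * al%:Z + c)%Z -> q = q'.
Proof.
move=> pp /andP[al0 alp] hq hq' d d'.
have hd : (p %| (q%:Z - q'%:Z) * al%:Z)%Z.
  rewrite (_ : _ * _ = (q%:Z * al%:Z + c) - (q'%:Z * al%:Z + c)); first exact: rpredB.
  ring.
move: hd; rewrite Gauss_dvdzl; last first.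
  by rewrite /coprimez /gcdz /= -[_ == _]/(coprime p al) prime_coprime // gtnNdvd.
rewrite dvdzE /= => hd; apply/eqP; rewrite -[_ == _]eqz_nat -subr_eq0 -absz_eq0.
case: (posnP (absz (q%:Z - q'%:Z))) => // h0.
have := dvdn_leq h0 hd; rewrite !mulSn in hq hq' *.
move: hq hq'; set jp := (j * p)%N; lia.
Qed.

Lemma sum_le1_unique (R : realType) (P : nat -> bool) (a b : nat) :
  (forall x y, (a <= x < b)%N -> (a <= y < b)%N -> P x -> P y -> x = y) ->
  \sum_(a <= x < b | P x) 1 <= 1 :> R.
Proof.
move=> hP; case: (boolP (has P (index_iota a b))) => [/hasP[x]|/hasPn h].
  rewrite mem_index_iota => xab Px.
  rewrite big_mkcond (bigD1_seq x) ?mem_index_iota ?iota_uniq //= Px.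
  rewrite big_nat_cond big1 ?addr0 // => y /andP[yab nyx]; case: ifP => // Py.
  by move: nyx; rewrite (hP _ _ yab xab Py Px) eqxx.
by rewrite big_nat_cond big1 // => y /andP[yab Py]; have := h y; rewrite mem_index_iota yab Py => /(_ isT).
Qed.

Definition harm (R : realType) (p : nat) : R := \sum_(1 <= r < p) r%:R^-1.

(** Each (al, r) is met by at most two q in the block, one for each sign. As q >= j p, only al with
    4 j e al < 1 occur, and there are at most 1 / (4 j e) of these; the sum of 1 / r remains. *)
Lemma resonance_block (R : realType) (e : R) (p j : nat) :
  prime p -> (0 < j)%N -> 0 < e ->
  \sum_(j * p <= q < j.+1 * p) resonance e p q <= harm R p / (2 * (j%:R * e)).
Proof.
move=> pp j0 e0; rewrite /resonance.
have pR : 0 < p%:R :> R by rewrite ltr0n prime_gt0.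
have jR : 0 < j%:R :> R by rewrite ltr0n.
rewrite exchange_big /= /harm mulr_suml; apply: ler_sum_nat => r /andP[r0 _].
pose y : R := 4 * (j%:R * e); have y0 : 0 < y by rewrite !mulr_gt0.
under eq_bigr do rewrite big_mkcond /=.
rewrite exchange_big /=.
apply: le_trans (_ : \sum_(1 <= al < p | al%:R * y < 1) (r%:R^-1 * 2) <= _); last first.
  rewrite -[X in \sum_(_ <= _ < _ | _) X]mulr1 -mulr_sumr.
  apply: le_trans (ler_wpM2l _ (card_small_multiples p y0)) _.
    by rewrite mulr_ge0 // invr_ge0.
  have -> : (2 * (j%:R * e))^-1 = 2 * y^-1 by rewrite /y; field; rewrite !gt_eqF.
  by rewrite -mulrA.
rewrite [leRHS]big_mkcond big_nat_cond [leRHS]big_nat_cond.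
apply: ler_sum => al /andP[/andP[al0 alp] _].
have alpp : (0 < al < p)%N by rewrite al0.
case: ifPn => [_|hy].
  apply: le_trans (_ : \sum_(j * p <= q < j.+1 * p)
     (r%:R^-1 * ((if (p %| q%:Z * al%:Z + - r%:Z)%Z then 1 else 0) +
                 (if (p %| q%:Z * al%:Z + r%:Z)%Z then 1 else 0))) <= _).
    apply: ler_sum => q _; have r1 : 0 <= r%:R^-1 :> R by rewrite invr_ge0.
    case: ifP => [/andP[_ /orP[->|->]]|_].
    - by case: ifP => _; lra.
    - by case: ifP => _; lra.
    - by do 2!case: ifP => _; lra.
  rewrite -mulr_sumr ler_pM2l ?invr_gt0 ?ltr0n // big_split /= -!big_mkcond /=.
  by rewrite -[2]/(1 + 1); apply: lerD; apply: sum_le1_unique => x x' hx hx' d d';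
     apply: (unique_in_block pp alpp hx hx' d d').
rewrite big_nat_cond big1 // => q /andP[/andP[hq _] _].
case: ifP => // /andP[h _]; case/negP: hy.
rewrite -(ltr_pM2r pR) mul1r; apply: le_lt_trans h.
have : (j * p)%:R <= q%:R :> R by rewrite ler_nat.
rewrite natrM => h1.
have h2 : y * p%:R <= 4 * q%:R * e by have := ler_wpM2l (ltW e0) h1; rewrite /y; lra.
by have := ler_wpM2l (ler0n R al) h2; lra.
Qed.

Lemma harm_le_ln (R : realType) (p : nat) : (0 < p)%N -> harm R p <= 1 + ln p%:R.
Proof.
(* The induction proves the stronger bound 1 + ln (p - 1), by means of ln (1 - 1 / n) <= - 1 / n.
   For p = 1 it relies on the convention ln 0 = 0. *)
move=> p0; apply: le_trans (_ : 1 + ln p.-1%:R <= _); last first.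
  rewrite lerD2l; case: p p0 => [|[|p]] // _; first by rewrite ln1 ln0.
  by rewrite ler_ln ?posrE ?ltr0n // ler_nat.
case: p p0 => [|[|p]] // _ /=; first by rewrite /harm big_geq // ln0 // addr0.
elim: p => [|p IH]; first by rewrite /harm big_nat1 ln1 invr1 addr0.
rewrite /harm big_nat_recr //= -/(harm R p.+2).
have p1R : 0 < p.+1%:R :> R by rewrite ltr0n.
have p2R : 0 < p.+2%:R :> R by rewrite ltr0n.
set i : R := p.+2%:R^-1.
have e : p.+1%:R = p.+2%:R * (1 + - i) :> R.
  by rewrite mulrDr mulr1 mulrN divff ?gt_eqF // -[p.+2%:R]natr1 addrK.
have i1 : i < 1 by rewrite invf_lt1 // ltr1n.
have i0 : 0 < 1 + - i by rewrite subr_gt0.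
have h : ln p.+1%:R = ln p.+2%:R + ln (1 + - i) by rewrite e lnM ?posrE.
have h' : ln (1 + - i) <= - i by apply: le_ln1Dx; rewrite ltrN2.
move: IH h h' => /=; move: (ln (1 + - i)) => a b c d; lra.
Qed.

Section DyadicDecay.
Variables (R : realType) (psi : nat -> R) (C : R).
Hypothesis psi0 : forall n, (0 < n)%N -> 0 < psi n.
Hypothesis psi_mono :
  forall m n, (0 < m)%N -> (m <= n)%N -> psi n / n%:R <= psi m / m%:R.
Hypothesis psi_decay :
  forall n m, (0 < n)%N -> \sum_(1 <= l < m) psi (2 ^ l * n)%N <= C * psi n.

Lemma sum_psi_div (p K : nat) : (0 < p)%N ->
  \sum_(p <= q < K.+1 * p) psi q / q%:R <= (1 + C) * psi p.
Proof.
move=> p0; rewrite sum_blocks.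
apply: le_trans (condensation K.+1 psi0 psi_mono psi_decay p0).
apply: ler_sum_nat => j /andP[j0 _].
have jp0 : (0 < j * p)%N by rewrite muln_gt0 j0.
apply: le_trans (_ : \sum_(j * p <= q < j.+1 * p) psi (j * p)%N / (j * p)%:R <= _).
  by apply: ler_sum_nat => q /andP[hq _]; apply: psi_mono.
rewrite sumr_const_nat mulSn addnK -[leLHS]mulr_natr natrM.
rewrite le_eqVlt; apply/orP; left; apply/eqP; field.
by rewrite !pnatr_eq0 -!lt0n j0 p0.
Qed.

(** On the block of j one has q <= 2 j p, hence psi q <= 2 psi (j p), and [resonance_block]
    contributes harm / (2 j psi p). The denominator [psi p] cancels the factor [psi p] produced by
    [condensation]. *)
Lemma sum_psi_resonance (p K : nat) : prime p ->
  \sum_(p <= q < K.+1 * p) psi q * resonance (psi p) p q <= (1 + C) * harm R p.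
Proof.
move=> pp; have p0 := prime_gt0 pp; have e0 := psi0 p0.
have h0 : 0 <= harm R p by apply: sumr_ge0 => i _; rewrite invr_ge0.
rewrite sum_blocks.
apply: le_trans (_ : \sum_(1 <= j < K.+1) psi (j * p)%N / j%:R * (harm R p / psi p) <= _).
  apply: ler_sum_nat => j /andP[j0 _].
  have jp0 : (0 < j * p)%N by rewrite muln_gt0 j0.
  have jR : 0 < j%:R :> R by rewrite ltr0n.
  have jpR : 0 < (j * p)%:R :> R by rewrite ltr0n.
  apply: le_trans (_ : \sum_(j * p <= q < j.+1 * p)
      2 * psi (j * p)%N * resonance (psi p) p q <= _).
    apply: ler_sum_nat => q /andP[hq hq2].
    apply: ler_wpM2r; first exact: resonance_ge0.
    have q0 : 0 < q%:R :> R by rewrite ltr0n (leq_trans jp0).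
    have := psi_mono jp0 hq; rewrite ler_pdivrMr // => h; apply: (le_trans h).
    rewrite mulrAC ler_pdivrMr // [2 * _]mulrC -mulrA.
    apply: ler_wpM2l; first exact/ltW/psi0.
    rewrite -natrM ler_nat (leq_trans (ltnW hq2)) // mulSn mul2n -addnn leq_add2r.
    exact: leq_pmull.
  rewrite -mulr_sumr.
  apply: le_trans (ler_wpM2l _ (resonance_block pp j0 e0)) _.
    by rewrite mulr_ge0 // ltW // psi0.
  rewrite le_eqVlt; apply/orP; left; apply/eqP; field.
  by rewrite !gt_eqF.
rewrite -mulr_suml.
have := condensation K.+1 psi0 psi_mono psi_decay p0 => h.
have hh : 0 <= harm R p / psi p by rewrite divr_ge0 // ltW.
apply: le_trans (ler_wpM2r hh h) _.
rewrite le_eqVlt; apply/orP; left; apply/eqP; field.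
by rewrite gt_eqF.
Qed.

(** Here [n q] stands for a number of meeting pairs and psi q / q is twice the length of an arc of
    q. The first term on the right is the one expected from independence; the second is the error,
    with 252 = 12 + 240. *)
Lemma overlap_sum (p N M : nat) (b : R) (n : nat -> R) : prime p -> 0 <= C ->
  (forall q, (p < q < N)%N -> prime q -> n q <= 12 * M%:R + 240 * b * (q%:R * psi p)
       + 240 * M%:R * (q%:R * psi p) * resonance (psi p) p q) ->
  \sum_(p.+1 <= q < N | prime q) n q * (psi q / q%:R) <=
  240 * b * psi p * (\sum_(p.+1 <= q < N | prime q) psi q) +
  252 * (1 + C) * (M%:R * psi p) * (1 + harm R p).
Proof.
move=> pp C0 hn; have p0 := prime_gt0 pp; have e0 := psi0 p0.
have h0 : 0 <= harm R p by apply: sumr_ge0 => i _; rewrite invr_ge0.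
(* Nonnegative terms may be summed over all integers of complete blocks instead of over primes. *)
have ext (F : nat -> R) : (forall q, (0 < q)%N -> 0 <= F q) ->
    \sum_(p.+1 <= q < N | prime q) F q <= \sum_(p <= q < N.+1 * p) F q.
  move=> F0; have [Np|pN] := leqP N p.
    rewrite big_geq; last by rewrite ltnW.
    by rewrite big_nat_cond; apply: sumr_ge0 => q /andP[/andP[hq _] _]; apply: F0; apply: leq_trans hq.
  have NK : (N <= N.+1 * p)%N by rewrite (leq_trans (leqnSn N)) // leq_pmulr.
  rewrite [leRHS](big_cat_nat (n := p.+1)) //=; last exact: leq_trans pN NK.
  rewrite [X in _ <= _ + X](big_cat_nat (n := N)) //=.
  rewrite big_nat1 -[leLHS]add0r; apply: lerD; first exact: F0.
  rewrite -[leLHS]addr0; apply: lerD.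
    rewrite big_mkcond big_nat_cond [leRHS]big_nat_cond.
    apply: ler_sum => q /andP[/andP[hq _] _]; case: ifP => // _.
    by apply: F0; apply: leq_trans hq.
  by rewrite big_nat_cond; apply: sumr_ge0 => q /andP[/andP[hq _] _]; apply: F0; lia.
apply: le_trans (_ : \sum_(p.+1 <= q < N | prime q)
   (12 * M%:R * (psi q / q%:R) + 240 * b * psi p * psi q
    + 240 * M%:R * psi p * (psi q * resonance (psi p) p q)) <= _).
  rewrite big_nat_cond [leRHS]big_nat_cond.
  apply: ler_sum => q /andP[hq pq].
  have q0 : 0 < q%:R :> R by rewrite ltr0n prime_gt0.
  have w0 : 0 <= psi q / q%:R by rewrite divr_ge0 // ltW // psi0 // prime_gt0.
  have := ler_wpM2r w0 (hn q hq pq).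
  move=> h; apply: (le_trans h); rewrite le_eqVlt; apply/orP; left; apply/eqP; field.
  by rewrite gt_eqF.
rewrite !big_split /= -!mulr_sumr.
have s1 : \sum_(p.+1 <= q < N | prime q) psi q / q%:R <= (1 + C) * psi p.
  apply: le_trans (ext _ _) (sum_psi_div N p0) => q q0.
  by rewrite divr_ge0 // ltW // psi0.
have s2 : \sum_(p.+1 <= q < N | prime q) psi q * resonance (psi p) p q <= (1 + C) * harm R p.
  apply: le_trans (ext _ _) (sum_psi_resonance N pp) => q q0.
  by rewrite mulr_ge0 ?resonance_ge0 // ltW // psi0.
have M0 : 0 <= 12 * M%:R :> R by rewrite mulr_ge0.
have M1 : 0 <= 240 * M%:R * psi p by rewrite !mulr_ge0 // ltW.
have r1 := ler_wpM2l M0 s1; have r2 := ler_wpM2l M1 s2.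
have a1 : 0 <= M%:R * psi p * (1 + C) by rewrite !mulr_ge0 // ?ltW //; lra.
have a2 := mulr_ge0 a1 h0.
lra.
Qed.

End DyadicDecay.

(** * The second moment inequality *)

(** Division-free form of the Cauchy-Schwarz bound. If f counts the sets containing a point, then 2
    t f <= t^2 + f^2 on the union and f = 0 off it; integrate. The parameter t is optimised by the
    caller. *)
Lemma second_moment d (T : measurableType d) (R : realType)
    (mu : {measure set T -> \bar R}) (I : eqType) (s : seq I) (B : I -> set T)
    (l : I -> R) (o : I -> I -> R) (t : R) :
  (forall i, measurable (B i)) -> 0 <= t ->
  {in s, forall i, mu (B i) = (l i)%:E} ->
  {in s &, forall i j, (mu (B i `&` B j) <= (o i j)%:E)%E} ->
  ((2 * t * \sum_(i <- s) l i)%:E <=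
   (t ^+ 2)%:E * mu (\big[setU/set0]_(i <- s) B i) +
   (\sum_(i <- s) \sum_(j <- s) o i j)%:E)%E.
Proof.
move=> mB t0 hl ho.
set W := \big[setU/set0]_(i <- s) B i.
have mW : measurable W by apply: bigsetU_measurable.
pose f x : R := \sum_(i <- s) \1_(B i) x.
have f0 x : 0 <= f x by apply: sumr_ge0 => i _.
have ptw x : ((2 * t * f x)%:E <= (t ^+ 2 * \1_W x + f x ^+ 2)%:E)%E.
  rewrite lee_fin; case: (boolP (x \in W)) => xW.
    rewrite indicE xW mulr1; have := sqr_ge0 (t - f x); rewrite sqrrB; lra.
  suff -> : f x = 0 by rewrite mulr0 expr0n /= addr0 mulr_ge0 ?sqr_ge0.
  rewrite /f big_seq big1 // => i si; rewrite indicE.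
  case: (boolP (x \in B i)) => // xB; case/negP: xW.
  rewrite /W (perm_big _ (perm_to_rem si)) big_cons; apply/mem_set; left.
  exact/set_mem.
have E1 : (\int[mu]_x (2 * t * f x)%:E = (2 * t * \sum_(i <- s) l i)%R%:E)%E.
  under eq_integral do rewrite EFinM /f -sumEFin.
  rewrite ge0_integralZl_EFin //; last 3 first.
  - by move=> x _; apply: sume_ge0 => i _; rewrite lee_fin.
  - by apply: emeasurable_sum => i; apply/measurable_EFinP; exact: measurable_indic.
  - by rewrite mulr_ge0.
  rewrite ge0_integral_sum //; last by move=> i; apply/measurable_EFinP; exact: measurable_indic.
  rewrite [RHS]EFinM -sumEFin; congr (_ * _)%E.
  rewrite big_seq [RHS]big_seq; apply: eq_bigr => i si.
  by rewrite integral_indic // setIT hl.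
have fsq x : (f x ^+ 2)%:E = (\sum_(i <- s) \sum_(j <- s) (\1_(B i `&` B j) x)%:E)%E.
  rewrite expr2 /f mulr_suml -sumEFin; apply: eq_bigr => i _.
  rewrite mulr_sumr -sumEFin; apply: eq_bigr => j _.
  by rewrite indicI.
rewrite -E1.
apply: le_trans (_ : (\int[mu]_x ((t ^+ 2 * \1_W x)%:E + (f x ^+ 2)%:E) <= _)%E).
  apply: ge0_le_integral => //.
  - by move=> x _; rewrite lee_fin !mulr_ge0.
  - apply/measurable_EFinP/measurable_funM => //; apply: measurable_sum => i.
    exact: measurable_indic.
  - apply: emeasurable_funD; first by apply/measurable_EFinP/measurable_funM => //; exact: measurable_indic.
    apply/measurable_EFinP/measurable_funX/measurable_sum => i.
    exact: measurable_indic.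
rewrite ge0_integralD //; last 4 first.
- by move=> x _; rewrite lee_fin mulr_ge0 ?sqr_ge0.
- by apply/measurable_EFinP/measurable_funM => //; exact: measurable_indic.
- by move=> x _; rewrite lee_fin sqr_ge0.
- by apply/measurable_EFinP/measurable_funX/measurable_sum => i; exact: measurable_indic.
apply: leeD.
  under eq_integral do rewrite EFinM.
  rewrite ge0_integralZl_EFin ?sqr_ge0 //; last by apply/measurable_EFinP; exact: measurable_indic.
  by rewrite integral_indic // setIT.
under eq_integral do rewrite fsq.
have mBB i j : measurable (B i `&` B j) by exact: measurableI.
rewrite ge0_integral_sum //; last 2 first.
- by move=> i; apply: emeasurable_sum => j; apply/measurable_EFinP; exact: measurable_indic.
- by move=> i x _; apply: sume_ge0 => j _; rewrite lee_fin.
rewrite -sumEFin big_seq [leRHS]big_seq; apply: lee_sum => i si.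
rewrite ge0_integral_sum //; last by move=> j; apply/measurable_EFinP; exact: measurable_indic.
rewrite -sumEFin big_seq [leRHS]big_seq; apply: lee_sum => j sj.
by rewrite integral_indic // setIT ho.
Qed.

(** * A set that misses a fixed proportion of every short interval is null *)

Section LebesgueNull.
Variables (R : realType) (B J : set R) (k : R).
Hypothesis k01 : 0 < k <= 1.
Hypothesis B_sparse : forall c d : R, c < d -> d - c <= 1 -> `[c, d] `<=` J ->
  exists W : set R, [/\ measurable W, W `<=` `[c, d], W `&` B = set0
    & ((k * (d - c))%:E <= lebesgue_measure W)%E].

Local Notation lambda_star := ((wlength (@idfun R))^*)%mu.

(** [B] is not assumed measurable, so the loss of proportion k is stated for the outer measure and
    for half-open intervals, the sets used in its coverings. Clipping by ]c, d] keeps the interval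
    inside J and its length at most 1. *)
Lemma outer_measure_sparse (a b c d : R) : `[c, d] `<=` J -> d - c <= 1 ->
  (lambda_star (B `&` `]c, d] `&` `]a, b]) <= (1 - k)%:E * wlength idfun `]a, b])%E.
Proof.
case/andP: k01 => k0 k1 cdJ cd1.
have k1' : 0 <= 1 - k by rewrite subr_ge0.
have wl0 : (0 <= (1 - k)%:E * wlength (@idfun R) `]a, b])%E.
  by rewrite mule_ge0 ?lee_fin //; exact: wlength_ge0.
pose a' := Num.max a c; pose b' := Num.min b d.
have sub : B `&` `]c, d] `&` `]a, b] `<=` B `&` `]a', b'].
  move=> x [[Bx /=]]; rewrite ?in_itv /= => /andP[h1 h2] /andP[h3 h4].
  by split => //; rewrite ?in_itv /= gt_max le_min h1 h2 h3 h4.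
apply: le_trans (le_outer_measure lambda_star _ _ sub) _.
have [ab|ba] := ltP a' b'; last first.
  rewrite (_ : B `&` _ = set0) ?outer_measure0 //.
  by apply/seteqP; split => x //= [_]; rewrite ?in_itv /= => /andP[h1 h2]; move: ba; rewrite leNgt (lt_le_trans h1 h2).
have ca : c <= a' by rewrite le_max lexx orbT.
have bd : b' <= d by rewrite ge_min lexx orbT.
have aa : a <= a' by rewrite le_max lexx.
have bb : b' <= b by rewrite ge_min lexx.
have ab1 : b' - a' <= 1 by lra.
have abJ : `[a', b'] `<=` J.
  apply: subset_trans cdJ => x /=; rewrite ?in_itv /= => /andP[h1 h2].
  by rewrite (le_trans ca h1) (le_trans h2 bd).
have [W [mW Wab WB hW]] := B_sparse ab ab1 abJ.
have sub2 : B `&` `]a', b'] `<=` `[a', b'] `\` W.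
  move=> x [Bx /=]; rewrite ?in_itv /= => /andP[h1 h2]; split; first by rewrite ltW.
  by move=> Wx; have : (W `&` B) x by []; rewrite WB.
apply: le_trans (le_outer_measure lambda_star _ _ sub2) _.
rewrite [leLHS](_ : _ = lebesgue_measure (`[a', b'] `\` W)) //.
have lab : lebesgue_measure (`[a', b']%classic : set R) = (b' - a')%:E.
  by rewrite lebesgue_measure_itv /= lte_fin ab.
rewrite measureD //=; last by rewrite lab ltry.
rewrite lab setIidr // wlength_itv_bnd; last lra.
apply: le_trans (_ : (b' - a')%:E - (k * (b' - a'))%:E <= _)%E.
  by apply: leeB.
rewrite -EFinB -EFinM lee_fin /=.
have := ler_wpM2l k1' (_ : b' - a' <= b - a); move=> /(_ ltac:(lra)); lra.
Qed.

(** An almost optimal covering shrinks by the factor 1 - k on each of its members, so the outer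
    measure x satisfies x <= (1 - k) (x + e) for all e > 0. *)
Lemma outer_measure_null_itv (c d : R) : `[c, d] `<=` J -> c <= d -> d - c <= 1 ->
  lambda_star (B `&` `]c, d]) = 0%E.
Proof.
case/andP: k01 => k0 k1 cdJ cd cd1.
set E := B `&` `]c, d].
have E0 : (0 <= lambda_star E)%E by exact: outer_measure_ge0.
have Efin : lambda_star E \is a fin_num.
  rewrite ge0_fin_numE //; apply: le_lt_trans (_ : lambda_star `]c, d] < _)%E.
    by apply: le_outer_measure => x [].
  rewrite [ltLHS](_ : _ = lebesgue_measure (`]c, d]%classic : set R)) //.
  by rewrite lebesgue_measure_itv /=; case: ifP => _; rewrite ?ltry // -EFinD ltry.
have [x xE] : exists x, lambda_star E = x%:E by exists (fine (lambda_star E)); rewrite fineK.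
rewrite xE in E0 *; rewrite lee_fin in E0.
have step e : 0 < e -> x <= (1 - k) * (x + e).
  move=> e0; have [_ [A [mA EA] <-] hA] := lb_ereal_inf_adherent e0 Efin.
  have sum0 : (0 <= \sum_(0 <= i <oo) wlength (@idfun R) (A i))%E.
    by apply: nneseries_ge0 => i _ _; exact: wlength_ge0.
  have h1 : (lambda_star E <= \sum_(0 <= i <oo) lambda_star (E `&` A i))%E.
    apply: le_trans (outer_measure_sigma_subadditive lambda_star _).
    apply: le_outer_measure; rewrite -setI_bigcupr => y Ey; split => //.
    exact: EA.
  have h2 : (\sum_(0 <= i <oo) lambda_star (E `&` A i) <=
             \sum_(0 <= i <oo) (1 - k)%:E * wlength (@idfun R) (A i))%E.
    apply: lee_nneseries => [i _ _|i _]; first exact: outer_measure_ge0.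
    have [[a b] _ <-] : ocitv (A i) := mA i; exact: outer_measure_sparse.
  rewrite nneseriesZl in h2; last by move=> i _; exact: wlength_ge0.
  rewrite -lee_fin EFinM [(x + e)%:E]EFinD -xE; apply: le_trans h1 (le_trans h2 _).
  by apply: lee_wpmul2l; rewrite ?lee_fin ?subr_ge0 // ltW.
apply/eqP; rewrite eqe; apply/eqP/le_anti; rewrite E0 andbT.
rewrite leNgt; apply/negP => x0.
have kx : 0 < k * x by rewrite mulr_gt0.
(* With this e, the inequality would give x <= x - k x / 2 - k^2 x / 2. *)
have := step (k * x / 2); rewrite divr_gt0 // => /(_ isT).
have : 0 <= k * (k * x) by rewrite mulr_ge0 // ltW.
lra.
Qed.

Lemma lebesgue_null : open J -> B `<=` J -> lebesgue_measure.-negligible B.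
Proof.
move=> oJ BJ.
pose good (u : rat * rat) := [/\ `[ratr u.1, ratr u.2] `<=` J,
   ratr u.1 <= ratr u.2 :> R & ratr u.2 - ratr u.1 <= 1 :> R].
(* The open set J is covered by countably many short intervals with rational endpoints;
   [choice.unpickle] enumerates the pairs of endpoints. *)
pose F (n : nat) : set R := if (choice.unpickle n : option (rat * rat)) is Some u then
   (if `[< good u >] then B `&` `]ratr u.1, ratr u.2] else set0) else set0.
have negF n : lebesgue_measure.-negligible (F n).
  rewrite /F; case: (choice.unpickle n : option (rat * rat)) => [u|]; last exact: negligible_set0.
  case: asboolP => [[h1 h2 h3]|_]; last exact: negligible_set0.
  apply/negligible_outer_measure; exact: outer_measure_null_itv.
apply: negligibleS (negligible_bigcup negF) => x Bx.
have /nbhs_ballP[e /= e0 he] : nbhs x J by apply: open_nbhs_nbhs; split => //; exact: BJ.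
pose e' := Num.min e 1; have e'0 : 0 < e' by rewrite lt_min e0 ltr01.
have [e'e e'1] : e' <= e /\ e' <= 1 by rewrite !ge_min !lexx orbT.
have [r1 r1x] : exists r : rat, ratr r \in `]x - e' / 2, x[ by apply: rat_in_itvoo; lra.
have [r2 r2x] : exists r : rat, ratr r \in `]x, x + e' / 2[ by apply: rat_in_itvoo; lra.
move: r1x r2x; rewrite ?in_itv /= => /andP[a1 a2] /andP[a3 a4].
exists (choice.pickle (r1, r2)); first exact: Logic.I.
rewrite /F choice.pickleK.
have gr : good (r1, r2).
  split => /=; try lra.
  move=> y; rewrite /= in_itv /= => /andP[b1 b2]; apply: he.
  rewrite /ball /= ltr_norml; apply/andP; split; lra.
rewrite asboolT //; split => //=; rewrite ?in_itv /=; lra.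
Qed.

End LebesgueNull.

(** * Derivatives, fractional parts and elementary counts *)

(** At an interior point of K the restriction to K disappears from the filter, so [deriv_in] agrees
    with the ordinary derivative and the mean value theorem becomes available. *)
Lemma is_derive_deriv_in (R : realType) (K : set R) (f : R -> R) (x : R) :
  nbhs x K -> cvg (diff_quot f x @ within K x^') ->
  is_derive x (1 : R) f (deriv_in K f x).
Proof.
move=> xK cf.
have sub : x^' --> within K x^'.
  move=> A hA; apply: filterS2 (nbhs_dnbhs xK) hA => y Ky; exact.
have c1 : diff_quot f x @ x^' --> deriv_in K f x.
  by apply: cvg_trans cf; apply: cvg_app.
have shift0 : (h + x) @[h --> (0 : R)^'] --> x^'.
  move=> A /nbhs_ballP[e /= e0 he]; apply/nbhs_ballP; exists e => //= h.
  rewrite /ball /= sub0r normrN => hh hN0; apply: he.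
    by rewrite /ball /= opprD addrCA subrr addr0 normrN.
  by rewrite -subr_eq0 addrK.
have c2 : (h^-1 *: ((f \o shift x) (h *: (1 : R)) - f x) @[h --> (0 : R)^']) -->
    deriv_in K f x.
  have := cvg_comp _ _ shift0 c1; apply: cvg_trans; apply: near_eq_cvg.
  near=> h; rewrite /= /diff_quot /shift /= addrK mulrC.
  by rewrite /GRing.scale /= mulr1.
apply: DeriveDef; first by apply/cvg_ex; exists (deriv_in K f x).
exact: cvg_lim c2.
Unshelve. all: by end_near.
Qed.

(** K and S are separate because derivatives are taken in the closure of J, whereas bounds are used
    on J or on a compact interval inside it. *)
Lemma lipschitz_deriv_in (R : realType) (K S : set R) (f : R -> R) (D : R) :
  is_interval S -> (forall x, S x -> nbhs x K) ->
  (forall x, S x -> cvg (diff_quot f x @ within K x^')) ->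
  (forall x, S x -> `|deriv_in K f x| <= D) ->
  forall x y, S x -> S y -> `|f x - f y| <= D * `|x - y|.
Proof.
move=> iS SK cf bf.
wlog xy : / forall x y, S x -> S y -> x <= y -> `|f x - f y| <= D * `|x - y|.
  apply=> x y Sx Sy xy.
  have inS z : z \in `[x, y] -> S z.
    by rewrite in_itv /= => hz; apply: (iS x y) => //; case/andP: hz => -> ->.
  have der z : z \in `[x, y] -> is_derive z (1 : R) f (deriv_in K f z).
    by move=> /inS Sz; apply: is_derive_deriv_in; [exact: SK|exact: cf].
  have derO z : z \in `]x, y[ -> is_derive z (1 : R) f (deriv_in K f z).
    rewrite in_itv /= => /andP[h1 h2].
    by apply: der; rewrite in_itv /= (ltW h1) (ltW h2).
  have cts : {within `[x, y], continuous f}.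
    by apply: derivable_within_continuous => z hz; have [] := der z hz.
  have [z zxy e] := MVT_segment xy derO cts.
  rewrite distrC e normrM [X in _ <= D * X]distrC ler_wpM2r //.
  by apply: bf; exact: inS.
move=> x y Sx Sy; have [h|h] := leP x y; first exact: xy.
by rewrite distrC [X in D * X]distrC; apply: xy => //; exact: ltW.
Qed.

Lemma dist_int_le (R : realType) (x : R) (m : int) : dist_int x <= `|x - m%:~R|.
Proof.
apply: ge_inf; last by exists m.
by exists 0 => _ [k _ <-].
Qed.

(** The margin eta prevents y from crossing an integer, so x and y have the same floor. *)
Lemma frac_part_near (R : realType) (s t eta x y : R) :
  0 <= s -> t < 1 -> s + eta <= frac_part x <= t - eta -> `|y - x| <= eta ->
  s <= frac_part y <= t.
Proof.
move=> s0 t1; rewrite /frac_part ler_norml => /andP[h1 h2] /andP[h3 h4].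
have -> : Num.floor y = Num.floor x.
  by apply: floor_def; rewrite intrD; apply/andP; split; lra.
by apply/andP; split; lra.
Qed.

Lemma dilate_int_window (R : realType) (n : nat) (c d : R) (m : int) :
  (0 < n)%N -> dilate_int n `[c, d]%classic m -> c <= m%:~R / n%:R <= d.
Proof.
move=> n0 [j /=]; rewrite in_itv /= => hj ->.
by rewrite mulrC mulKf // pnatr_eq0 -lt0n.
Qed.

Lemma card_dilate_int (R : realType) (n : nat) (c d : R) :
  (0 < n)%N -> c <= d -> finite_set (dilate_int n `[c, d]%classic) ->
  n%:R * (d - c) - 1 <= #|` fset_set (dilate_int n `[c, d]%classic)|%:R :> R.
Proof.
move=> n0 cd fin.
have nR : 0 < n%:R :> R by rewrite ltr0n.
pose x := n%:R * (d - c); have x0 : 0 <= x by rewrite mulr_ge0 // subr_ge0.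
pose K := absz (Num.floor x).
have KE : K%:R = (Num.floor x)%:~R :> R by rewrite natr_absz ger0_norm ?floor_ge0.
pose F (i : nat) : int := Num.ceil (n%:R * c) + i%:Z.
have FS i : (i < K)%N -> dilate_int n `[c, d]%classic (F i).
  move=> iK; exists ((F i)%:~R / n%:R); last by rewrite mulrC divfK // gt_eqF.
  rewrite /= in_itv /= ler_pdivlMr // ler_pdivrMr // /F intrD.
  have c1 := ceil_ge (n%:R * c); have := ceilB1_lt (n%:R * c); rewrite intrB => c2.
  have f1 := floor_le x.
  have : i.+1%:R <= K%:R :> R by rewrite ler_nat.
  rewrite KE -natr1 -[i%:Z%:~R]/(i%:R) => h.
  have i0 : 0 <= i%:R :> R by [].
  rewrite /x in f1 h; apply/andP; split; lra.
apply: le_trans (_ : K%:R <= _).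
  rewrite KE -/x; have := floorD1_gt x; rewrite intrD; lra.
rewrite ler_nat -[leqLHS](size_iota 0 K) -(size_map F) cardfE cardE.
rewrite -(size_map val); apply: uniq_leq_size.
  by rewrite map_inj_uniq ?iota_uniq // => i j; rewrite /F => /addrI [].
move=> _ /mapP[i + ->]; rewrite mem_iota add0n => iK.
have iS : F i \in fset_set (dilate_int n `[c, d]%classic).
  by rewrite in_fset_set // inE; exact: FS.
by apply/mapP; exists [` iS]%fset => //; rewrite mem_enum.
Qed.

Lemma sum_sym_split (R : realType) (P : pred nat) (F : nat -> nat -> R) (a N : nat) :
  (forall p q, F p q = F q p) ->
  \sum_(a <= p < N | P p) \sum_(a <= q < N | P q) F p q =
  \sum_(a <= p < N | P p) F p p
  + 2 * \sum_(a <= p < N | P p) \sum_(p.+1 <= q < N | P q) F p q.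
Proof.
move=> Fsym; case: (leqP a N) => [|Na]; last by rewrite !(big_geq (ltnW Na)) mulr0 addr0.
elim: N => [|N IH] aN; first by rewrite !(big_geq (leq0n a)) mulr0 addr0.
case: (ltngtP a N.+1) aN => // [|->]; last by rewrite !(big_geq (leqnn _)) mulr0 addr0.
rewrite ltnS => aN _.
have rec (G : nat -> R) m : (m <= N)%N -> \sum_(m <= p < N.+1 | P p) G p =
    \sum_(m <= p < N | P p) G p + (if P N then G N else 0).
  by move=> mN; rewrite big_mkcond big_nat_recr //= -big_mkcond.
have -> : \sum_(a <= p < N.+1 | P p) \sum_(a <= q < N.+1 | P q) F p q =
    \sum_(a <= p < N | P p) \sum_(a <= q < N | P q) F p q +
    \sum_(a <= p < N | P p) (if P N then F p N else 0) +
    (if P N then \sum_(a <= q < N | P q) F N q + F N N else 0).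
  rewrite rec // -big_split /=; congr (_ + _).
    by apply: eq_bigr => p _; rewrite rec.
  by case: ifP => // PN; rewrite rec // PN.
rewrite IH // !(rec _ a) //.
have -> : \sum_(a <= p < N | P p) \sum_(p.+1 <= q < N.+1 | P q) F p q =
    \sum_(a <= p < N | P p) \sum_(p.+1 <= q < N | P q) F p q +
    \sum_(a <= p < N | P p) (if P N then F p N else 0).
  rewrite -big_split /= big_nat_cond [RHS]big_nat_cond; apply: eq_bigr => p.
  by move=> /andP[/andP[_ pN] _]; rewrite rec.
case: ifP => PN; last by rewrite !(big1_eq, addr0).
rewrite [\sum_(N.+1 <= q < N.+1 | _) _]big_geq //.
have -> : \sum_(a <= q < N | P q) F N q = \sum_(a <= q < N | P q) F q N by apply: eq_bigr.
lra.
Qed.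

(** * Arcs around approximate solutions and the measure of their union *)

(** First iterate, starting from m / n, towards the solution theta of n theta + phi n theta = m. It
    is also the point at which (C1) samples [rho n]. *)
Definition center (R : realType) (phi : nat -> R -> R) (i : nat * int) : R :=
  (i.2%:~R - phi i.1 (i.2%:~R / i.1%:R)) / i.1%:R.

(** On the arc, n theta differs from n times the centre by at most psi n / 4. The rest of the
    tolerance psi n is left for the change of [phi n] between m / n and theta. *)
Definition arc (R : realType) (psi : nat -> R) (phi : nat -> R -> R)
    (i : nat * int) : set R :=
  `[center phi i - psi i.1 / (4 * i.1%:R), center phi i + psi i.1 / (4 * i.1%:R)].

(** From ln p >= 2 follows 2 + ln p <= (ln p)^2, which lets the square of the logarithm dominate 1 +
    [harm]. *)
Lemma ln_ge2 (R : realType) (p : nat) : (16 <= p)%N -> 2 <= ln (p%:R : R).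
Proof.
move=> p16; have h : 2 <= ln (16 : R).
  have -> : (16 : R) = (2^-1 ^+ 4)^-1 by rewrite exprVn invrK -natrX.
  rewrite lnV ?posrE ?exprn_gt0 ?invr_gt0 // lnXn ?invr_gt0 //.
  have := @le_ln1Dx R (- 2^-1); rewrite ltrN2 invf_lt1 // ltr1n => /(_ isT).
  rewrite (_ : 1 + - 2^-1 = 2^-1 :> R); last by field.
  rewrite -mulr_natr; lra.
apply: (le_trans h); rewrite ler_ln ?posrE ?ltr0n ?(leq_trans _ p16) //.
by rewrite ler_nat.
Qed.

(** With T = sum psi p, the arcs have total length S >= kap b T / 2 and total overlap Q <= 242 b
    T^2, so their union has measure at least S^2 / Q >= kap^2 b / 968. No dependence on k or N
    remains. *)
Lemma limsup_measure (R : realType) (psi D : nat -> R) (phi : nat -> R -> R)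
    (G : nat -> seq int) (J : set R) (C B b c kap : R) (k N : nat) :
  (forall n, (0 < n)%N -> 0 < psi n < 1) ->
  (forall m n, (0 < m)%N -> (m <= n)%N -> psi n / n%:R <= psi m / m%:R) ->
  (forall n m, (0 < n)%N -> \sum_(1 <= l < m) psi (2 ^ l * n)%N <= C * psi n) ->
  0 <= C -> 0 <= B -> 0 < b <= 1 -> 0 < kap ->
  (16 <= k)%N -> 1 <= b * k%:R ->
  (forall x, c <= x <= c + b -> J x) ->
  (forall n x, (0 < n)%N -> J x -> `|phi n x| <= B) ->
  (forall n x y, (k <= n)%N -> J x -> J y -> `|phi n x - phi n y| <= D n * `|x - y|) ->
  (forall n, (k <= n)%N -> 0 <= D n) ->
  (forall m n, (k <= m)%N -> (m <= n)%N -> D n <= D m) ->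
  (forall n, (k <= n)%N -> D n * (2 * B + 1) <= psi n * n%:R) ->
  (forall n, (k <= n)%N -> D n <= n%:R / 2) ->
  (forall n, (k <= n)%N -> D n / psi n + 1 <= b * n%:R) ->
  (forall n, (k <= n)%N -> [/\ uniq (G n), kap * (b * n%:R) <= (size (G n))%:R &
     {in G n, forall m : int, c <= m%:~R / n%:R <= c + b}]) ->
  1 <= b * \sum_(k <= p < N | prime p) psi p ->
  504 * (1 + C) * (\sum_(k <= p < N | prime p) Num.max (psi p) (D p) * ln p%:R ^+ 2) <=
    b * (\sum_(k <= p < N | prime p) psi p) ^+ 2 ->
  ((kap ^+ 2 * b / 968)%:E <= lebesgue_measure
     (\big[setU/set0]_(i <- [seq (p, m) | p <- [seq p <- index_iota k N | prime p], m <- G p])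
        arc psi phi i))%E.
Proof.
move=> psi01 psim psid C0 B0 /andP[b0 b1] kap0 k16 bk SJ phiB phiL D0 Dm D1 D2 D3 hG bT hB3.
pose theta := center phi; pose ball := arc psi phi.
set T := \sum_(k <= p < N | prime p) psi p in bT hB3 *.
set s := [seq _ | p <- _, m <- _].
have psi0 n : (0 < n)%N -> 0 < psi n by move=> /psi01 /andP[].
have k0 : (0 < k)%N by apply: leq_trans k16.
have sP i : i \in s -> [/\ prime i.1, (k <= i.1)%N & i.2 \in G i.1].
  rewrite /s => /allpairsPdep[p [m H]]; case: H => hp mG -> /=; move: hp.
  by rewrite mem_filter mem_index_iota => /andP[pp /andP[kp _]].
pose l (i : nat * int) : R := psi i.1 / (2 * i.1%:R).
pose rad (i : nat * int) : R := psi i.1 / (4 * i.1%:R).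
pose close i j := `|theta i - theta j| <= rad i + rad j.
pose o i j : R := if close i j then Num.min (l i) (l j) else 0.
have rad0 i : i \in s -> 0 < rad i.
  move=> /sP[pp _ _]; have p0 := prime_gt0 pp.
  by rewrite divr_gt0 ?mulr_gt0 ?ltr0n // psi0.
have lE i : l i = rad i + rad i.
  rewrite /l /rad; have [->|h] := eqVneq (i.1%:R : R) 0; last by field.
  by rewrite !mulr0 invr0 !mulr0 addr0.
have lball i : i \in s -> lebesgue_measure (ball i) = (l i)%:E.
  move=> /rad0 ri; rewrite /ball /arc lebesgue_measure_itv /= lte_fin -/(rad i).
  rewrite ifT; last lra.
  by rewrite -EFinB lE; congr EFin; ring.
have oball : {in s &, forall i j, (lebesgue_measure (ball i `&` ball j) <= (o i j)%:E)%E}.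
  move=> i j si sj; rewrite /o; case: ifP => hc.
    rewrite /Num.min; case: ifP => _; rewrite -lball //; apply: le_measure;
      rewrite ?inE; try (exact: measurable_itv); try (by apply: measurableI; exact: measurable_itv).
    - by move=> x [].
    - by move=> x [].
  rewrite (_ : ball i `&` ball j = set0) ?measure0 //.
  apply/seteqP; split => // x; rewrite /ball /arc => -[/=]; rewrite !in_itv /= -/(rad i) -/(rad j) -/(theta i) -/(theta j).
  move=> /andP[h1 h2] /andP[h3 h4]; move/negP: hc; apply; rewrite /close ler_norml.
  by apply/andP; split; lra.
have osym i j : o i j = o j i.
  by rewrite /o /close distrC [rad i + _]addrC [Num.min (l i) _]minC.
pose TT p q : R := \sum_(m <- G p) \sum_(m' <- G q) o (p, m) (q, m').
have TTsym p q : TT p q = TT q p.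
  by rewrite /TT exchange_big /=; apply: eq_bigr => m _; apply: eq_bigr => m' _; exact: osym.
have sum_s (F : nat * int -> R) :
    \sum_(i <- s) F i = \sum_(k <= p < N | prime p) \sum_(m <- G p) F (p, m).
  by rewrite /s big_allpairs_dep big_filter.
have sum_o : \sum_(i <- s) \sum_(j <- s) o i j =
    \sum_(k <= p < N | prime p) \sum_(k <= q < N | prime q) TT p q.
  rewrite sum_s; apply: eq_bigr => p _.
  under eq_bigr do rewrite sum_s.
  by rewrite exchange_big.
have Tpp p : prime p -> (k <= p)%N -> TT p p <= psi p.
  move=> pp kp; have p0 := prime_gt0 pp.
  have [uG _ Gw] := hG p kp.
  have pR : 0 < p%:R :> R by rewrite ltr0n.
  have bp : 1 <= b * p%:R.
    by apply: (le_trans bk); rewrite ler_pM2l // ler_nat.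
  have /andP[ps0 ps1] := psi01 p p0.
  (* Since D p <= p / 2, centres for distinct m are at least 1 / (2 p) apart, while the two radii
     add up to psi p / (2 p) < 1 / (2 p). *)
  have off m m' : m \in G p -> m' \in G p -> m != m' -> o (p, m) (p, m') = 0.
    move=> mG mG' nmm; rewrite /o ifF //; apply/negbTE; rewrite /close -ltNge.
    set x := m%:~R / p%:R : R; set x' := m'%:~R / p%:R : R.
    have Jx : J x by apply: SJ; exact: Gw.
    have Jx' : J x' by apply: SJ; exact: Gw.
    have L := phiL p x x' kp Jx Jx'; have D2p := D2 p kp.
    have exx : p%:R * (x - x') = m%:~R - m'%:~R.
      by rewrite /x /x'; field; rewrite gt_eqF.
    have nm : 1 <= `|m%:~R - m'%:~R| :> R.
      by rewrite -intrB -intr_norm ler1z -gtz0_ge1 normr_gt0 subr_eq0.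
    have nx : 1 <= p%:R * `|x - x'|.
      by rewrite -[X in X * _]gtr0_norm // -normrM exx.
    have n0 : 0 <= `|x - x'| by [].
    have L2 := ler_wpM2r n0 D2p.
    have tt : theta (p, m) - theta (p, m') =
        (p%:R * (x - x') - (phi p x - phi p x')) / p%:R.
      by rewrite exx /theta /center /= -/x -/x' -mulrBl; congr (_ / _); ring.
    rewrite tt normrM [X in _ * X]gtr0_norm ?invr_gt0 // /rad /=.
    rewrite (_ : psi p / _ + _ = (psi p / 2) / p%:R); last by field; rewrite gt_eqF.
    rewrite ltr_pM2r ?invr_gt0 //.
    have h0 : `|p%:R * (x - x')| = p%:R * `|x - x'| by rewrite normrM gtr0_norm.
    have h1 : `|p%:R * (x - x')| <=
        `|p%:R * (x - x') - (phi p x - phi p x')| + `|phi p x - phi p x'|.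
      by rewrite -[X in `|X| <= _](subrK (phi p x - phi p x')) ler_normD.
    by clear -L L2 nx h0 h1 ps1; lra.
  have -> : TT p p = \sum_(m <- G p) l (p, 0).
    rewrite /TT big_seq [RHS]big_seq; apply: eq_bigr => m mG.
    rewrite (bigD1_seq m) //= [X in _ + X]big_seq_cond big1 ?addr0.
      rewrite /o /close subrr normr0 ifT ?minxx //.
      by rewrite addr_ge0 // /rad divr_ge0 ?ltW // mulr_gt0.
    by move=> m' /andP[mG' nmm]; apply: off => //; rewrite eq_sym.
  rewrite big_const_seq count_predT iter_addr_0 -mulr_natr /l /=.
  have Gsz : (size (G p))%:R <= b * p%:R + 1.
    apply: (@size_le_window _ _ (c * p%:R)) => //; first by rewrite mulr_ge0 // ltW.
    by move=> m /Gw; rewrite ler_pdivlMr // ler_pdivrMr // mulrDl.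
  have bp1 : b * p%:R <= p%:R by rewrite ger_pMl.
  have p1 : 1 <= p%:R :> R by rewrite ler1n.
  rewrite mulrAC ler_pdivrMr ?mulr_gt0 // ler_pM2l //; clear -Gsz bp1 p1; lra.
have Tpq p q : prime p -> prime q -> (k <= p)%N -> (p < q)%N ->
  2 * TT p q <= (size [seq u <- [seq (m, m') | m <- G p, m' <- G q] |
                   close (p, u.1) (q, u.2)])%:R * (psi q / q%:R).
  move=> pp pq kp lpq; have q0 := prime_gt0 pq; have p0 := prime_gt0 pp.
  have qR : 0 < q%:R :> R by rewrite ltr0n.
  rewrite size_filter -sum1_count natr_sum mulr_suml big_mkcond big_allpairs_dep /=.
  rewrite /TT mulr_sumr; apply: ler_sum => m _; rewrite mulr_sumr; apply: ler_sum => m' _.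
  rewrite /o; case: ifP => _; last by rewrite mulr0.
  rewrite mul1r; apply: le_trans (_ : 2 * l (q, m') <= _).
    by rewrite ler_pM2l // ge_min lexx orbT.
  by rewrite /l /= le_eqVlt; apply/orP; left; apply/eqP; field; rewrite gt_eqF.
(* Number of pieces on which [phi p] varies by at most [psi p]. It satisfies M p * psi p <= D p +
   psi p, the source of the maximum in (B3). *)
pose M p := (absz (Num.floor (D p / psi p))).+1.
have ME p : (k <= p)%N -> (M p)%:R = (Num.floor (D p / psi p))%:~R + 1 :> R.
  move=> kp; have p0 : (0 < p)%N := leq_trans k0 kp.
  rewrite /M -natr1 natr_absz ger0_norm // floor_ge0 divr_ge0 ?D0 // ltW // psi0 //.
have npq_le p q : prime p -> prime q -> (k <= p)%N -> (p < q)%N ->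
  (size [seq u <- [seq (m, m') | m <- G p, m' <- G q] | close (p, u.1) (q, u.2)])%:R <=
  12 * (M p)%:R + 240 * b * (q%:R * psi p)
  + 240 * (M p)%:R * (q%:R * psi p) * resonance (psi p) p q.
  move=> pp pq kp lpq; have q0 := prime_gt0 pq; have p0 := prime_gt0 pp.
  have kq : (k <= q)%N by apply: leq_trans (ltnW lpq).
  have qR : 0 < q%:R :> R by rewrite ltr0n.
  have pR : 0 < p%:R :> R by rewrite ltr0n.
  have /andP[ps0 ps1] := psi01 p p0.
  have [uGp _ Gp] := hG p kp; have [uGq _ Gq] := hG q kq.
  have Mp := ME p kp.
  have f1 := floor_le (D p / psi p); have f2 := floorD1_gt (D p / psi p).
  have D3p := D3 p kp; have D0p := D0 p kp.
  (* The function [phi q] inherits the Lipschitz constant [D p] because [D] is non-increasing. If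
     the arcs meet, m / p and m' / q are at most (2 B + 1) / p apart: 2 B for the two shifts by
     [phi], 1 for the radii. *)
  apply: (@pair_count R p q (M p) _ (phi p) (phi q) J c b (D p) (2 * B + 1) (psi p)) => //.
  - by rewrite prime_coprime // dvdn_prime2 // neq_ltn lpq.
  - by rewrite filter_uniq // allpairs_uniq // => -[x y] [x' y'] _ _.
  - by rewrite b0.
  - by rewrite Mp; clear -f1 D3p; lra.
  - apply: le_trans (_ : D p <= _); first by rewrite ler_piMr.
    by rewrite -ler_pdivrMr // Mp; move: f2; rewrite intrD => /ltW.
  - by rewrite [leRHS]mulrC; move: (D1 p kp); rewrite [psi p * _]mulrC.
  - by move=> x y; exact: phiL.
  - move=> x y Jx Jy; apply: le_trans (phiL q x y kq Jx Jy) _.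
    by apply: ler_wpM2r => //; apply: Dm => //; exact: ltnW.
  move=> [m m']; rewrite mem_filter => /andP[/= hc /allpairsP[[m1 m2] /= [mG mG' [e1 e2]]]].
  subst m1 m2.
  set x := m%:~R / p%:R : R; set x' := m'%:~R / q%:R : R.
  have Jx : J x by apply: SJ; exact: Gp.
  have Jx' : J x' by apply: SJ; exact: Gq.
  have Fx := phiB p x p0 Jx; have Fx' := phiB q x' q0 Jx'.
  have hc2 : `|theta (p, m) - theta (q, m')| <= psi p / (2 * p%:R).
    apply: (le_trans hc); rewrite /rad /=.
    have h := psim p q p0 (ltnW lpq).
    have -> : psi p / (2 * p%:R) = psi p / p%:R / 4 + psi p / p%:R / 4.
      by field; rewrite gt_eqF.
    have -> : psi p / (4 * p%:R) = psi p / p%:R / 4 by field; rewrite gt_eqF.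
    have -> : psi q / (4 * q%:R) = psi q / q%:R / 4 by field; rewrite gt_eqF.
    by clear -h; lra.
  have tp : theta (p, m) = x - phi p x / p%:R by rewrite /theta /center /= mulrBl.
  have tq : theta (q, m') = x' - phi q x' / q%:R by rewrite /theta /center /= mulrBl.
  split => //; first exact: Gp.
    have -> : x' - x = (theta (q, m') - theta (p, m)) + (phi q x' / q%:R - phi p x / p%:R).
      by rewrite tp tq; ring.
    apply: le_trans (ler_normD _ _) _.
    rewrite distrC; apply: le_trans (lerD hc2 (ler_normB _ _)) _.
    have i0 : 0 < p%:R^-1 :> R by rewrite invr_gt0.
    have j0 : 0 < q%:R^-1 :> R by rewrite invr_gt0.
    have ji : q%:R^-1 <= p%:R^-1 :> R by rewrite lef_pV2 ?posrE // ler_nat ltnW.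
    rewrite !normrM (gtr0_norm i0) (gtr0_norm j0).
    have h1 := ler_wpM2r (ltW i0) Fx; have h2 := ler_wpM2r (ltW j0) Fx'.
    have h3 := ler_wpM2l B0 ji.
    have -> : psi p / (2 * p%:R) = psi p * p%:R^-1 / 2 by field; rewrite gt_eqF.
    have h4 := ler_wpM2r (ltW i0) (ltW ps1).
    by clear -h1 h2 h3 h4 i0; lra.
  have -> : q%:R * m%:~R - p%:R * m'%:~R - (q%:R * phi p x - p%:R * phi q x') =
     p%:R * q%:R * (theta (p, m) - theta (q, m')).
    by rewrite tp tq /x /x'; field; rewrite !gt_eqF.
  rewrite normrM gtr0_norm ?mulr_gt0 //.
  apply: le_trans (ler_wpM2l _ hc2) _; first by rewrite mulr_ge0.
  have -> : p%:R * q%:R * (psi p / (2 * p%:R)) = q%:R * psi p / 2 by field; rewrite gt_eqF.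
  by have := mulr_gt0 qR ps0; clear; lra.
have T0 : 0 <= T.
  rewrite /T big_nat_cond; apply: sumr_ge0 => p /andP[/andP[kp _] _].
  by rewrite ltW // psi0 // (leq_trans k0).
pose HH p : R := Num.max (psi p) (D p) * ln p%:R ^+ 2.
(* 504 is twice the 252 of [overlap_sum], because D p + psi p <= 2 max(psi p, D p). *)
have off_le p : prime p -> (k <= p)%N ->
    2 * \sum_(p.+1 <= q < N | prime q) TT p q <= 240 * b * (psi p * T) + 504 * (1 + C) * HH p.
  move=> pp kp; have p0 := prime_gt0 pp; have ps0 := psi0 p p0.
  have ov := @overlap_sum R psi C psi0 psim psid p N (M p) b
    (fun q => (size [seq u <- [seq (m, m') | m <- G p, m' <- G q] | close (p, u.1) (q, u.2)])%:R)
    pp C0.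
  rewrite mulr_sumr; apply: le_trans (_ : _ <= _) (le_trans (ov _) _).
  - rewrite big_nat_cond [leRHS]big_nat_cond; apply: ler_sum => q /andP[/andP[lpq _] pq].
    exact: Tpq.
  - by move=> q /andP[lpq _] pq; exact: npq_le.
  have hT : \sum_(p.+1 <= q < N | prime q) psi q <= T.
    have [Np|pN] := leqP N p; first by rewrite big_geq // leqW.
    rewrite /T (big_cat_nat (n := p.+1) (m := k)) //=; last exact: leqW.
    rewrite lerDr big_nat_cond; apply: sumr_ge0 => q /andP[/andP[kq _] _].
    by rewrite ltW // psi0 // (leq_trans k0).
  have L2 : 2 <= ln (p%:R : R) by apply: ln_ge2; exact: leq_trans kp.
  have hharm := harm_le_ln R p0.
  have Mps : (M p)%:R * psi p <= D p + psi p.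
    rewrite ME // mulrDl mul1r lerD2r -ler_pdivlMr //; exact: floor_le.
  have mx1 : psi p <= Num.max (psi p) (D p) by rewrite le_max lexx.
  have mx2 : D p <= Num.max (psi p) (D p) by rewrite le_max lexx orbT.
  have hl : 1 + harm R p <= ln p%:R ^+ 2.
    have L0 : 0 <= ln (p%:R : R) by apply: le_trans L2.
    by rewrite expr2; have := ler_wpM2r L0 L2; clear -hharm L2; lra.
  apply: lerD.
    by rewrite -!mulrA; apply: ler_wpM2l => //; do 2![apply: ler_wpM2l; first exact: ltW].
  have c1 : 0 <= 252 * (1 + C) by clear -C0; lra.
  have mm : 0 <= (M p)%:R * psi p by rewrite mulr_ge0 // ltW.
  have h0 : 0 <= 1 + harm R p.
    by rewrite addr_ge0 //; apply: sumr_ge0 => i _; rewrite invr_ge0.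
  have : (M p)%:R * psi p * (1 + harm R p) <= 2 * HH p.
    rewrite /HH mulrA; apply: ler_pM => //; clear -Mps mx1 mx2 hl; lra.
  by move=> h; have := ler_wpM2l c1 h; clear; lra.
(* 242 = 1 + 240 + 1: the diagonal is at most T <= b T^2 as b T >= 1, the main term is 240 b T^2,
   and [hB3] bounds the error by b T^2. *)
have Q_le : \sum_(i <- s) \sum_(j <- s) o i j <= 242 * b * T ^+ 2.
  rewrite sum_o sum_sym_split // mulr_sumr.
  have a1 : \sum_(k <= p < N | prime p) TT p p <= T.
    rewrite /T big_nat_cond [leRHS]big_nat_cond; apply: ler_sum => p /andP[/andP[kp _] pp].
    exact: Tpp.
  have a2 : \sum_(k <= p < N | prime p) 2 * (\sum_(p.+1 <= q < N | prime q) TT p q) <=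
      240 * b * (T * T) + b * T ^+ 2.
    apply: le_trans (_ : \sum_(k <= p < N | prime p)
       (240 * b * (psi p * T) + 504 * (1 + C) * HH p) <= _).
      rewrite big_nat_cond [leRHS]big_nat_cond; apply: ler_sum => p /andP[/andP[kp _] pp].
      exact: off_le.
    by rewrite big_split /= -!mulr_sumr -mulr_suml lerD2l.
  apply: le_trans (lerD a1 a2) _.
  have := ler_wpM2r T0 bT; rewrite expr2; clear; lra.
have S_ge : kap * b / 2 * T <= \sum_(i <- s) l i.
  rewrite sum_s /T mulr_sumr big_nat_cond [leRHS]big_nat_cond.
  apply: ler_sum => p /andP[/andP[kp _] pp]; have p0 := prime_gt0 pp.
  have [_ sz _] := hG p kp.
  have pR : 0 < p%:R :> R by rewrite ltr0n.
  rewrite /l /= big_const_seq count_predT iter_addr_0 -[X in _ <= X]mulr_natr.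
  have hh : 0 <= psi p / (2 * p%:R) by rewrite divr_ge0 // ?mulr_ge0 // ltW // psi0.
  apply: le_trans (ler_wpM2l hh sz); rewrite le_eqVlt; apply/orP; left; apply/eqP.
  by field; rewrite gt_eqF.
have Tp : 0 < T.
  by rewrite lt_neqAle T0 andbT eq_sym; apply/eqP => T00; move: bT; rewrite T00 mulr0 ler10.
(* The optimal t is Q / S for the bounds 242 b T^2 and kap b T / 2. *)
pose t := 484 * T / kap.
have t0 : 0 < t by apply: divr_gt0; [lra|exact: kap0].
have mball i : measurable (ball i) by exact: measurable_itv.
have sm := @second_moment _ _ R lebesgue_measure _ s ball l o t mball (ltW t0) lball oball.
suff concl (w : \bar R) : ((2 * t * \sum_(i <- s) l i)%:E <= (t ^+ 2)%:E * w +
     (\sum_(i <- s) \sum_(j <- s) o i j)%:E)%E -> ((kap ^+ 2 * b / 968)%:E <= w)%E.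
  exact: concl sm.
clear sm; case: w => [w| |]; last 2 first.
- by rewrite leey.
- by rewrite mulrNy gtr0_sg ?exprn_gt0 // mul1e addNye leeNy_eq.
rewrite -EFinM -EFinD !lee_fin => h.
have kt : kap * t = 484 * T by rewrite /t mulrC divfK ?gt_eqF.
have h1 : 484 * b * T ^+ 2 <= 2 * t * \sum_(i <- s) l i.
  have := ler_wpM2l (ltW t0) S_ge.
  have -> : t * (kap * b / 2 * T) = (kap * t) * b / 2 * T by ring.
  rewrite kt expr2; lra.
have h2 : 242 * b * T ^+ 2 <= t ^+ 2 * w by lra.
rewrite -(ler_pM2l (exprn_gt0 2 t0)); apply: le_trans h2.
have -> : t ^+ 2 * (kap ^+ 2 * b / 968) = (kap * t) ^+ 2 * b / 968 by ring.
rewrite kt le_eqVlt; apply/orP; left; apply/eqP; by field.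
Qed.

(** * Inequalities extracted from the limit hypotheses *)

(** Turns (B3), (B4) and (C2), whose sup norms may be infinite, into eventual inequalities; an
    infinite numerator would make the quotient infinite. *)
Lemma ediv_cvg0 (R : realType) (s : nat -> \bar R) (w : nat -> R) (n0 : nat) :
  (forall n, (n0 <= n)%N -> 0 < w n) ->
  (forall n, (n0 <= n)%N -> (0 <= s n)%E) ->
  (fun n => (s n / (w n)%:E)%E) @ \oo --> 0%E ->
  forall e, 0 < e -> exists N, forall n, (N <= n)%N -> (s n <= (e * w n)%:E)%E.
Proof.
move=> w0 s0 /fine_cvgP[fin /cvgrPdist_lt cv] e e0.
have [N _ hN] := filterI (cv e e0) fin.
exists (maxn N n0) => n; rewrite geq_max => /andP[Nn n0n].
have [/= + hf] := hN n Nn; have wn := w0 n n0n.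
move: hf; rewrite sub0r normrN inver gt_eqF //.
have := s0 n n0n; case: (s n) => [x| |] //= x0 hf.
  rewrite lee_fin -ler_pdivrMr //.
  by move=> h; apply: le_trans (ler_norm _) (ltW h).
by move: hf; rewrite mulyr gtr0_sg ?invr_gt0 // mul1e.
Qed.

Lemma supnorm_ge0 (R : realType) (K : set R) (f : R -> R) :
  K !=set0 -> (0 <= supnorm K f)%E.
Proof.
move=> [x Kx]; apply: le_trans (_ : (`|f x|%:E <= _)%E); first by rewrite lee_fin.
by apply: ereal_sup_ubound; exists x.
Qed.

Lemma le_supnorm (R : realType) (K : set R) (f : R -> R) (M : R) :
  (supnorm K f <= M%:E)%E -> forall x, K x -> `|f x| <= M.
Proof.
move=> h x Kx; rewrite -lee_fin; apply: le_trans h.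
by apply: ereal_sup_ubound; exists x.
Qed.

Lemma dyadic_decay (R : realType) (psi : nat -> R) :
  (forall n, (0 < n)%N -> 0 < psi n) ->
  (ereal_sup
     [set \sum_(1 <= l <oo) (psi (2 ^ l * n)%N * l%:R ^+ 2 / psi n)%:E
        | n in [set n | (0 < n)%N]] < +oo)%E ->
  exists2 C, 0 <= C &
    forall n m, (0 < n)%N -> \sum_(1 <= l < m) psi (2 ^ l * n)%N <= C * psi n.
Proof.
move=> psi0; set M := ereal_sup _ => Moo.
have term0 n l : (0 < n)%N -> 0 <= psi (2 ^ l * n)%N * l%:R ^+ 2 / psi n.
  move=> n0; rewrite divr_ge0 ?mulr_ge0 ?sqr_ge0 //; apply: ltW; apply: psi0 => //.
  by rewrite muln_gt0 expn_gt0.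
have partial n m : (0 < n)%N ->
    ((\sum_(1 <= l < m) (psi (2 ^ l * n)%N * l%:R ^+ 2 / psi n))%:E <= M)%E.
  move=> n0; apply: le_trans (_ : \sum_(1 <= l <oo) (psi (2 ^ l * n)%N * l%:R ^+ 2 / psi n)%:E <= _)%E.
    rewrite -sumEFin; apply: nneseries_lim_ge => l _ _.
    by rewrite lee_fin term0.
  by apply: ereal_sup_ubound; exists n.
have M0 : (0 <= M)%E by have := partial 1%N 0%N isT; rewrite big_geq.
have Mfin : M = (fine M)%:E by rewrite fineK // ge0_fin_numE.
exists (fine M); first exact: fine_ge0.
move=> n m n0; rewrite -ler_pdivrMr ?psi0 // mulr_suml -lee_fin -Mfin.
apply: le_trans (partial n m n0); rewrite lee_fin; apply: ler_sum_nat => l /andP[l0 _].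
rewrite ler_pM2r ?invr_gt0 ?psi0 // ler_peMr //.
  by apply: ltW; apply: psi0; rewrite muln_gt0 expn_gt0.
by rewrite exprn_ege1 // ler1n.
Qed.

Lemma sum_primes_unbounded (R : realType) (psi : nat -> R) :
  (forall n, (0 < n)%N -> 0 < psi n) ->
  (\sum_(0 <= p <oo | prime p) (psi p)%:E = +oo)%E ->
  forall K, exists N0, forall N, (N0 <= N)%N -> K <= \sum_(0 <= p < N | prime p) psi p.
Proof.
move=> psi0 hoo K.
have mono m n : (m <= n)%N -> \sum_(0 <= p < m | prime p) psi p <= \sum_(0 <= p < n | prime p) psi p.
  move=> mn; rewrite [leRHS](big_cat_nat (n := m)) //= lerDl.
  by apply: sumr_ge0 => p pp; apply/ltW/psi0/prime_gt0.
apply: contrapT => hN.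
have bd N : \sum_(0 <= p < N | prime p) psi p <= K.
  rewrite leNgt; apply/negP => h; apply: hN; exists N => m Nm.
  by apply: le_trans (ltW h) (mono _ _ Nm).
have : (\sum_(0 <= p <oo | prime p) (psi p)%:E <= K%:E)%E.
  apply: lime_le.
    by apply: is_cvg_nneseries => p _ pp; rewrite lee_fin; apply/ltW/psi0/prime_gt0.
  by apply: nearW => N; rewrite sumEFin lee_fin.
by rewrite hoo leye_eq.
Qed.

(** Of the factor 1/4, one half comes from keeping half of the limiting proportion eta, the other
    from having at least (d - c) n - 1 >= (d - c) n / 2 integers in the window. *)
Lemma equidistributes_count (R : realType) (F : nat -> int -> R) (c d eta : R)
    (A : set R) :
  equidistributes_mod1 (fun n => dilate_int n `[c, d]%classic) F -> c < d ->
  is_interval A -> A `<=` `[0, 1[ -> lebesgue_measure A = eta%:E -> 0 < eta ->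
  exists N, forall n, (N <= n)%N -> exists G : seq int,
    [/\ uniq G, eta / 4 * ((d - c) * n%:R) <= (size G)%:R &
      {in G, forall m, c <= m%:~R / n%:R <= d /\ A (frac_part (F n m))}].
Proof.
move=> [fin eq] cd iA A01 mA eta0.
have := eq A iA A01; rewrite mA => /fine_cvgP[_ /cvgr_gt] /(_ (eta / 2)).
have e2 : eta / 2 < eta by lra.
move=> /(_ e2)[N _ hN].
have [N1 hN1] : exists N1 : nat, 2 <= (d - c) * N1%:R.
  exists (Num.truncn (2 / (d - c))).+1; rewrite mulrC -ler_pdivrMr ?subr_gt0 //.
  by apply: ltW; apply: truncnS_gt.
exists (maxn 1 (maxn N N1)) => n; rewrite !geq_max => /and3P[n0 Nn N1n].
have := hN n Nn => /=; set S := dilate_int n _; set S' := [set m | _].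
have finS : finite_set S by apply: fin.
have finS' : finite_set S' by apply: sub_finite_set finS => m [].
move=> hr; exists (enum_fset (fset_set S')); split.
- exact: fset_uniq.
- have dn : 2 <= (d - c) * n%:R.
    by apply: le_trans hN1 _; rewrite ler_pM2l ?subr_gt0 // ler_nat.
  have cS : n%:R * (d - c) - 1 <= #|` fset_set S|%:R :> R.
    by apply: card_dilate_int => //; exact: ltW.
  have S0 : 0 < #|` fset_set S|%:R :> R by lra.
  move: hr; rewrite ltr_pdivlMr // => hr.
  apply: le_trans (ltW hr).
  have := ler_wpM2l (ltW eta0) cS; have := ler_wpM2l (ltW eta0) dn; lra.
- move=> m; rewrite in_fset_set // inE => -[Sm Am]; split => //.
  exact: dilate_int_window.
Qed.

(** As m / n lies in the middle half of [c, d], the centre and the whole arc stay in [c, d], where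
    the Lipschitz bounds hold. Then [phi n] changes by at most psi n / 2 between m / n and x, and
    [rho n] by at most eta / 4 between the centre and x. *)
Lemma arc_good (R : realType) (psi : nat -> R) (phi rho : nat -> R -> R)
    (n : nat) (m : int) (c d B D L eta s t x : R) :
  (0 < n)%N -> 0 < psi n < 1 -> 0 <= B -> 0 <= D -> 0 <= L ->
  (forall y, c <= y <= d -> `|phi n y| <= B) ->
  (forall y z, c <= y <= d -> c <= z <= d -> `|phi n y - phi n z| <= D * `|y - z|) ->
  (forall y z, c <= y <= d -> c <= z <= d -> `|rho n y - rho n z| <= L * `|y - z|) ->
  D * (2 * B + 1) <= psi n * n%:R -> psi n * L <= eta * n%:R ->
  8 * B <= (d - c) * n%:R -> 2 <= (d - c) * n%:R ->
  c + (d - c) / 4 <= m%:~R / n%:R <= d - (d - c) / 4 ->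
  0 <= s -> t < 1 -> s + eta <= frac_part (rho n (center phi (n, m))) <= t - eta ->
  arc psi phi (n, m) x ->
  [/\ c <= x <= d, dist_int (x * n%:R + phi n x) <= psi n & s <= frac_part (rho n x) <= t].
Proof.
move=> n0 /andP[ps0 ps1] B0 D0 L0 phiB phiL rhoL hD hL hB h2 /andP[m1 m2] s0 t1 hf.
have nR : 0 < n%:R :> R by rewrite ltr0n.
set z := m%:~R / n%:R in m1 m2 *.
rewrite /arc /= in_itv /= => hx.
have dc : 0 < d - c by rewrite -(pmulr_lgt0 _ nR); lra.
have zI : c <= z <= d by apply/andP; split; lra.
have eth : center phi (n, m) = z - phi n z / n%:R by rewrite /center /= mulrBl.
set th := center phi (n, m) in eth hf hx *.
pose i : R := n%:R^-1.
have i0 : 0 < i by rewrite invr_gt0.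
have ni : n%:R * i = 1 by rewrite /i divff ?gt_eqF.
have w1 : `|th - z| <= B * i.
  rewrite eth addrAC subrr add0r normrN normrM [X in _ * X <= _]gtr0_norm //.
  by apply: ler_wpM2r; [exact: ltW|exact: phiB].
have Bi : B * i <= (d - c) / 8.
  have := ler_wpM2r (ltW i0) hB; rewrite -[(d - c) * _ * _]mulrA ni; lra.
have pi : psi n * i <= (d - c) / 2.
  have h3 := ler_wpM2r (ltW i0) h2; rewrite -[(d - c) * _ * _]mulrA ni in h3.
  have := ler_wpM2r (ltW i0) (ltW ps1); lra.
have pin : psi n / (4 * n%:R) = psi n * i / 4 by rewrite /i; field; rewrite gt_eqF.
rewrite pin in hx.
have w2 : `|x - th| <= psi n * i / 4 by rewrite ler_norml; case/andP: hx => ? ?; apply/andP; split; lra.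
have thI : c <= th <= d by move: w1; rewrite ler_norml => /andP[? ?]; apply/andP; split; lra.
have xI : c <= x <= d.
  by move: w1 w2; rewrite !ler_norml => /andP[? ?] /andP[? ?]; apply/andP; split; lra.
split => //.
- apply: le_trans (dist_int_le _ m) _.
  have -> : x * n%:R + phi n x - m%:~R = n%:R * (x - th) + (phi n x - phi n z).
    by rewrite eth /z; field; rewrite gt_eqF.
  have xz : `|x - z| <= psi n * i / 4 + B * i.
    rewrite (_ : x - z = (x - th) + (th - z)); last ring.
    exact: le_trans (ler_normD _ _) (lerD w2 w1).
  have h3 := phiL _ _ xI zI.
  have h4 := ler_wpM2l D0 xz.
  have h5 : psi n * i / 4 + B * i <= (2 * B + 1) * i / 2.
    have := ler_wpM2r (ltW i0) (ltW ps1); lra.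
  have h6 := ler_wpM2l D0 h5.
  have h7 := ler_wpM2r (ltW i0) hD; rewrite -[psi n * _ * _]mulrA ni in h7.
  have h8 : `|n%:R * (x - th)| <= psi n / 4.
    rewrite normrM gtr0_norm //; have := ler_wpM2l (ltW nR) w2.
    suff -> : n%:R * (psi n * i / 4) = psi n / 4 by [].
    by transitivity (psi n * (n%:R * i) / 4); [ring|rewrite ni mulr1].
  apply: le_trans (ler_normD _ _) _; lra.
- apply: (frac_part_near s0 t1 hf).
  have h3 := rhoL _ _ xI thI; have h4 := ler_wpM2l L0 w2.
  have h5 := ler_wpM2r (ltW i0) hL; rewrite -[eta * _ * _]mulrA ni in h5.
  have h6 : 0 <= psi n * L * i by rewrite !mulr_ge0 // ltW.
  lra.
Qed.

(** Sums starting at 0 are replaced by sums from k: N is taken so large that the tail T exceeds the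
    head T0. Then (T0 + T)^2 <= 4 T^2, whence (B3) is invoked with e / 4. *)
Lemma prime_sums_tail (R : realType) (psi D : nat -> R) (sup : nat -> \bar R)
    (k : nat) (e b : R) :
  (forall n, (0 < n)%N -> 0 < psi n) -> (forall n, (0 <= sup n)%E) ->
  (forall n, (k <= n)%N -> sup n = (D n)%:E) ->
  (\sum_(0 <= p <oo | prime p) (psi p)%:E = +oo)%E ->
  (fun N : nat => ((\sum_(p < N.+1 | prime p)
       maxe (psi p)%:E (sup p) * ((ln (p%:R : R)) ^+ 2)%:E)
     / ((\sum_(p < N.+1 | prime p) psi p) ^+ 2)%:E)%E) @ \oo --> 0%E ->
  0 < e -> 0 < b -> exists N, 1 <= b * \sum_(k <= p < N | prime p) psi p /\
    \sum_(k <= p < N | prime p) Num.max (psi p) (D p) * ln p%:R ^+ 2 <=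
      e * (\sum_(k <= p < N | prime p) psi p) ^+ 2.
Proof.
move=> psi0 sup0 supD hoo B3 e0 b0.
have [N1 hN1] := sum_primes_unbounded psi0 hoo 1.
have pp0 p : prime p -> 0 <= psi p by move=> pp; apply/ltW/psi0/prime_gt0.
have tm0 p : (0 <= maxe (psi p)%:E (sup p) * ((ln (p%:R : R)) ^+ 2)%:E)%E.
  apply: mule_ge0; last by rewrite lee_fin sqr_ge0.
  by rewrite le_max sup0 orbT.
pose tot n := \sum_(0 <= p < n | prime p) psi p.
have totE n : \sum_(p < n.+1 | prime p) psi p = tot n.+1 by rewrite /tot big_mkord.
have w0 n : (N1 <= n)%N -> 0 < (\sum_(p < n.+1 | prime p) psi p) ^+ 2.
  move=> hn; rewrite exprn_gt0 // totE; apply: lt_le_trans (hN1 n.+1 (leqW hn)).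
  exact: ltr01.
have s0 n : (N1 <= n)%N -> (0 <= \sum_(p < n.+1 | prime p)
    maxe (psi p)%:E (sup p) * ((ln (p%:R : R)) ^+ 2)%:E)%E by move=> _; apply: sume_ge0.
have [N2 hN2] := ediv_cvg0 w0 s0 B3 (divr_gt0 e0 (ltr0n R 4)).
pose T0 := tot k; have T00 : 0 <= T0 by apply: sumr_ge0.
have [N3 hN3] := sum_primes_unbounded psi0 hoo (2 * T0 + 2 / b).
pose N := maxn k (maxn N2 N3).
exists N.+1; set T := \sum_(k <= p < N.+1 | prime p) psi p.
have kN : (k <= N.+1)%N by apply: leqW; exact: leq_maxl.
have N2N : (N2 <= N)%N by rewrite /N !leq_max leqnn orbT.
have N3N : (N3 <= N.+1)%N by apply: leqW; rewrite /N !leq_max leqnn !orbT.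
have eT : tot N.+1 = T0 + T by rewrite /tot (big_cat_nat (n := k)).
have big := hN3 _ N3N; rewrite -/(tot _) eT in big.
have ib0 : 0 < 2 / b by rewrite divr_gt0.
have T1 : 2 / b <= T by lra.
split.
  by have := ler_wpM2l (ltW b0) T1; rewrite mulrCA divff ?gt_eqF // mulr1; lra.
have := hN2 N N2N; rewrite totE eT => h.
rewrite -lee_fin; apply: le_trans (_ : ((e / 4 * (T0 + T) ^+ 2)%:E <= _)%E); last first.
  rewrite lee_fin -mulrA ler_pM2l // -(ler_pM2l (ltr0n R 4)) mulrA divff ?mul1r ?pnatr_eq0 //.
  have -> : 4 * T ^+ 2 = (2 * T) ^+ 2 by ring.
  rewrite ler_sqr ?nnegrE; lra.
apply: le_trans h.
rewrite -(big_mkord (fun p => prime p)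
  (fun p => maxe (psi p)%:E (sup p) * ((ln (p%:R : R)) ^+ 2)%:E)%E).
rewrite [leRHS](big_cat_nat (n := k)) //=.
rewrite -[leLHS]add0e; apply: leeD; first by apply: sume_ge0.
rewrite -sumEFin [leLHS]big_nat_cond [leRHS]big_nat_cond.
apply: lee_sum => p /andP[/andP[kp _] _].
by rewrite supD // EFinM EFin_max.
Qed.

(** * From the arcs to almost every theta *)

Unset Implicit Arguments.
Set Strict Implicit.
Set Printing Implicit Defensive.

Theorem theorem1p1 (R : realType) (J : set R)
  (J_open : open J) (J_itv : is_interval J) (J_neq0 : J !=set0)
  (psi : nat -> R)
  (psi_range : forall n, (0 < n)%N -> 0 < psi n < 1 / 10%:R)
  (A1 : (ereal_sup
           [set \sum_(1 <= l <oo) (psi (2 ^ l * n)%N * l%:R ^+ 2 / psi n)%:E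
              | n in [set n | (0 < n)%N]] < +oo)%E)
  (A2 : forall m n, (0 < m)%N -> (m <= n)%N -> psi n / n%:R <= psi m / m%:R)
  (A3 : exists2 c : R, 1 < c & forall n, (0 < n)%N -> psi n < c * psi (2 * n)%N)
  (A4 : (\sum_(0 <= p <oo | prime p) (psi p)%:E = +oo)%E)
  (phi : nat -> R -> R)
  (phi_C1 : forall n, (0 < n)%N -> C1_on (closure J) (phi n))
  (B1 : (ereal_sup [set supnorm (closure J) (phi n) | n in [set n | (0 < n)%N]]
           < +oo)%E)
  (B2 : exists n0, forall m n, (n0 <= m)%N -> (m <= n)%N ->
          (supnorm (closure J) (deriv_in (closure J) (phi n))
           <= supnorm (closure J) (deriv_in (closure J) (phi m)))%E)
  (B3 : (fun N : nat =>
          ((\sum_(p < N.+1 | prime p)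
              maxe (psi p)%:E
                (supnorm (closure J) (deriv_in (closure J) (phi p)))
              * ((ln (p%:R : R)) ^+ 2)%:E)
           / ((\sum_(p < N.+1 | prime p) psi p) ^+ 2)%:E)%E)
          @ \oo --> 0%E)
  (B4 : (fun n : nat =>
          (supnorm (closure J) (deriv_in (closure J) (phi n))
           / (n%:R * psi n)%:E)%E)
          @ \oo --> 0%E)
  (rho : nat -> R -> R)
  (rho_C1 : forall n, (0 < n)%N -> C1_on (closure J) (rho n))
  (C1 : forall J' : set R,
          nondegenerate_interval J' -> bounded_set J' -> J' `<` J ->
          equidistributes_mod1 (fun n => dilate_int n J')
            (fun n m => rho n ((m%:~R - phi n (m%:~R / n%:R)) / n%:R)))
  (C2 : forall J' : set R,
          nondegenerate_interval J' -> bounded_set J' -> J' `<` J ->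
          (fun n : nat =>
            ((psi n)%:E * supnorm (closure J') (deriv_in (closure J) (rho n))
             / (n%:R)%:E)%E)
            @ \oo --> 0%E)
  (I : set R) (I_itv : nondegenerate_interval I) (I_sub : I `<=` `[0, 1[) :
    {ae (@lebesgue_measure R), forall theta : R, J theta ->
     infinite_set [set n : nat | [/\ (0 < n)%N,
        dist_int (theta * n%:R + phi n theta) <= psi n
        & I (frac_part (rho n theta))]]}.
Proof.
have psi0 n : (0 < n)%N -> 0 < psi n by move=> /psi_range/andP[].
have psi1 n : (0 < n)%N -> 0 < psi n < 1.
  move=> /psi_range/andP[-> h] /=; apply: lt_trans h _.
  by rewrite ltr_pdivrMr // mul1r ltr1n.
have [C C0 psid] := dyadic_decay psi0 A1.
set K := closure J.
have JK : J `<=` K by exact: subset_closure.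
have K0 : K !=set0 by case: J_neq0 => x Jx; exists x; exact: JK.
have nK x : J x -> nbhs x K.
  by move=> Jx; apply: filterS JK _; exact: open_nbhs_nbhs.
have [B B0 phiB] : exists2 B, 0 <= B &
    forall n x, (0 < n)%N -> J x -> `|phi n x| <= B.
  set M := ereal_sup _ in B1.
  have supM n : (0 < n)%N -> (supnorm K (phi n) <= M)%E.
    by move=> n0; apply: ereal_sup_ubound; exists n.
  have M0 : (0 <= M)%E by apply: le_trans (supM 1%N isT); exact: supnorm_ge0.
  exists (fine M); first exact: fine_ge0.
  move=> n x n0 /JK; apply: le_supnorm.
  by rewrite fineK ?ge0_fin_numE // supM.
pose sup n := supnorm K (deriv_in K (phi n)).
have sup0 n : (0 <= sup n)%E by exact: supnorm_ge0.
(* [fine] sends an infinite sup norm to 0, so [D] is only meaningful once (B4) has shown the norm to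
   be finite. *)
pose D n := fine (sup n).
have D0 n : 0 <= D n by exact: fine_ge0.
have D_small e : 0 < e -> exists N, forall n, (N <= n)%N ->
    sup n = (D n)%:E /\ D n <= e * (n%:R * psi n).
  move=> e0; have w0 n : (1 <= n)%N -> 0 < n%:R * psi n.
    by move=> n0; rewrite mulr_gt0 ?ltr0n ?psi0.
  have [N hN] := ediv_cvg0 w0 (fun n _ => sup0 n) B4 e0.
  exists N => n Nn; have h := hN n Nn.
  have f : sup n \is a fin_num by rewrite ge0_fin_numE // (le_lt_trans h) ?ltry.
  by split; [rewrite fineK|rewrite -lee_fin fineK].
have [N0 hN0] := D_small 1 ltr01.
have phiL n x y : (N0.+1 <= n)%N -> J x -> J y -> `|phi n x - phi n y| <= D n * `|x - y|.
  move=> hn; have n0 : (0 < n)%N by apply: leq_trans hn.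
  have [sD _] := hN0 n (ltnW hn).
  apply: (lipschitz_deriv_in J_itv nK) => z Jz.
    by have [h _] := phi_C1 n n0; apply: h; exact: JK.
  by apply: (le_supnorm (K := K)); [rewrite -/(sup n) sD|exact: JK].
have [I_conv [u [v [Iu Iv uv]]]] := I_itv.
have u0 : 0 <= u by have := I_sub _ Iu; rewrite /= in_itv /= => /andP[].
have v1 : v < 1 by have := I_sub _ Iv; rewrite /= in_itv /= => /andP[].
(* [A] is the middle third of [u, v]; eta is both its measure and the margin that [arc_good]
   consumes on each side. *)
pose eta := (v - u) / 3; have eta0 : 0 < eta by rewrite divr_gt0 ?subr_gt0.
pose A : set R := `[u + eta, v - eta]%classic.
have AE : u + eta <= v - eta by rewrite /eta; lra.
have A_itv : is_interval A by exact: interval_is_interval.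
have A01 : A `<=` `[0, 1[.
  move=> x; rewrite /A /= !in_itv /= => /andP[h1 h2]; apply/andP; split; lra.
have mA : lebesgue_measure A = eta%:E.
  rewrite /A lebesgue_measure_itv /= lte_fin ifT; last by rewrite /eta; lra.
  by rewrite -EFinB; congr EFin; rewrite /eta; field.
pose kap := eta / 4; have kap0 : 0 < kap by rewrite divr_gt0.
have kap1 : kap <= 1 by rewrite /kap /eta; lra.
(* 1936 = 2 * 968, since arcs are placed over an interval of length b = (d - c) / 2 only. *)
pose kappa := kap ^+ 2 / 1936.
have kappa01 : 0 < kappa <= 1.
  have h1 : kap ^+ 2 <= 1 by apply: exprn_ile1 => //; exact: ltW.
  have h2 : 0 < kap ^+ 2 by exact: exprn_gt0.
  by rewrite /kappa; clear -h1 h2; apply/andP; split; lra.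
have [n0 hB2] := B2.
pose good n theta := [/\ (0 < n)%N, dist_int (theta * n%:R + phi n theta) <= psi n
        & I (frac_part (rho n theta))].
have sparse k0 c d : c < d -> d - c <= 1 -> `[c, d] `<=` J -> exists W : set R,
    [/\ measurable W, W `<=` `[c, d],
        W `&` [set theta | J theta /\ forall n, (k0 <= n)%N -> ~ good n theta] = set0
      & ((kappa * (d - c))%:E <= lebesgue_measure W)%E].
  move=> cd cd1 cdJ.
  have cJ : J c by apply: cdJ; rewrite /= in_itv /= lexx ltW.
  (* The points m / n are taken from the middle half [c1, c1 + b] of [c, d], so that the shift by
     phi n / n does not lead out of [c, d]. *)
  pose b := (d - c) / 2; pose c1 := c + (d - c) / 4.
  have b0 : 0 < b by rewrite divr_gt0 ?subr_gt0.
  have b1 : b <= 1 by rewrite /b; clear -cd cd1; lra.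
  have itv_nd (x y : R) : x < y -> nondegenerate_interval `[x, y]%classic.
    move=> xy; split; first exact: interval_is_interval.
    by exists x, y; split; rewrite //= in_itv /= lexx ltW.
  have itv_bd (x y : R) : bounded_set `[x, y]%classic.
    by apply: compact_bounded; exact: segment_compact.
  have cd_prop : `[c, d]%classic `<` J.
    split => // JK'; have /nbhs_ballP[e /= e0 he] : nbhs c J by exact: open_nbhs_nbhs.
    have : J (c - e / 2).
      by apply: he; rewrite /ball /= opprB addrC subrK gtr0_norm ?divr_gt0 //; clear -e0; lra.
    by move=> /JK'; rewrite /= in_itv /=; clear -e0; lra.
  have SJ x : c1 <= x <= c1 + b -> J x.
    move=> h; apply: cdJ; rewrite /= in_itv /=.
    by move: h; rewrite /c1 /b; clear -cd => /andP[? ?]; apply/andP; split; lra.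
  have cb_prop : `[c1, c1 + b]%classic `<` J.
    split; first by move=> x; rewrite /= in_itv /=; exact: SJ.
    by move=> /(_ c cJ); rewrite /= in_itv /= /c1; clear -cd; lra.
  have c1b : c1 < c1 + b by rewrite ltrDl.
  have [N1 hN1] := equidistributes_count (C1 _ (itv_nd _ _ c1b) (itv_bd _ _) cb_prop)
    c1b A_itv A01 mA eta0.
  have /choice[G hG] : forall n, exists G : seq int, (N1 <= n)%N -> [/\ uniq G,
      kap * (b * n%:R) <= (size G)%:R &
      {in G, forall m : int, c1 <= m%:~R / n%:R <= c1 + b /\
         A (frac_part (rho n (center phi (n, m))))}].
    move=> n; case: (leqP N1 n) => [/hN1[G [g1 g2 g3]]|_]; last by exists [::].
    exists G => _; split => //; apply: le_trans g2.
    by rewrite (_ : c1 + b - c1 = b) //; ring.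
  pose sr n := supnorm (closure `[c, d]%classic) (deriv_in K (rho n)).
  have cdK : closure (`[c, d]%classic : set R) !=set0.
    by exists c; apply: subset_closure; rewrite /= in_itv /= lexx ltW.
  have sr0 n : (0 <= sr n)%E by exact: supnorm_ge0.
  pose L n := fine (sr n); have L0 n : 0 <= L n by exact: fine_ge0.
  have nR1 n : (1 <= n)%N -> 0 < n%:R :> R by rewrite ltr0n.
  have psr0 n : (1 <= n)%N -> (0 <= (psi n)%:E * sr n)%E.
    by move=> n1; rewrite mule_ge0 // lee_fin ltW // psi0.
  have [N2 hN2] := ediv_cvg0 nR1 psr0 (C2 _ (itv_nd _ _ cd) (itv_bd _ _) cd_prop) eta0.
  (* Since psi n > 0, a finite bound on the product shows that the sup norm itself is finite. *)
  have rhoP n : (N2 <= n)%N -> (0 < n)%N -> sr n = (L n)%:E /\ psi n * L n <= eta * n%:R.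
    move=> Nn n1; have h := hN2 n Nn; rewrite -/(sr n) in h.
    have f : sr n \is a fin_num.
      rewrite ge0_fin_numE //; move: h (sr0 n); case: (sr n) => [x _ _|h _|//].
        exact: ltry.
      by move: h; rewrite mulry gtr0_sg ?psi0 // mul1e leye_eq.
    by split; [rewrite fineK|rewrite -lee_fin EFinM fineK].
  have rhoL n y z : (N2 <= n)%N -> (0 < n)%N -> c <= y <= d -> c <= z <= d ->
      `|rho n y - rho n z| <= L n * `|y - z|.
    move=> Nn n1 hy hz; have [sL _] := rhoP n Nn n1.
    have cdN x : `[c, d]%classic x -> nbhs x K by move=> /cdJ; exact: nK.
    have cf x : `[c, d]%classic x -> cvg (diff_quot (rho n) x @ within K x^').
      by move=> /cdJ Jx; have [h _] := rho_C1 n n1; apply: h; exact: JK.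
    have bf x : `[c, d]%classic x -> `|deriv_in K (rho n) x| <= L n.
      move=> xcd; apply: (le_supnorm (K := closure `[c, d]%classic)).
        by rewrite -/(sr n) sL.
      exact: subset_closure.
    apply: (@lipschitz_deriv_in R K `[c, d]%classic (rho n) (L n)
      (@interval_is_interval R `[c, d]) cdN cf bf); by rewrite /= in_itv.
  (* The bound b / 2 serves D / psi + 1 <= b n; the other one gives D (2 B + 1) <= psi n * n and eps
     <= 1/4, hence D <= n / 2. *)
  pose eps := Num.min (b / 2) (4 * (B + 1))^-1.
  have eps0 : 0 < eps by rewrite lt_min divr_gt0 //= invr_gt0; clear -B0; lra.
  have eps1 : eps <= b / 2 by rewrite ge_min lexx.
  have eps2 : eps * (4 * (B + 1)) <= 1.
    by rewrite -ler_pdivlMr ?mul1r ?ge_min ?lexx ?orbT //; clear -B0; lra.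
  have eps4 : eps <= 4^-1.
    by have := mulr_ge0 (ltW eps0) B0; clear -eps2; lra.
  have [N3 hN3] := D_small eps eps0.
  (* From [N4] on, b n >= 2; from [N5] on, (d - c) n >= 8 B. In [k], the summand [k0] makes every
     arc yield a good n >= k0, and 16 is required by [ln_ge2]. *)
  pose N4 := (Num.truncn (2 / b)).+1; pose N5 := (Num.truncn (8 * B / (d - c))).+1.
  pose k := (k0 + 16 + N0.+1 + N1 + N2 + N3 + N4 + N5 + n0)%N.
  have big n : (k <= n)%N -> [/\ (k0 <= n)%N, (0 < n)%N, (N0.+1 <= n)%N, (N1 <= n)%N & (N2 <= n)%N].
    by rewrite /k => kn; clearbody N4 N5; clear -kn; split; lia.
  have big2 n : (k <= n)%N -> [/\ (N3 <= n)%N, (N4 <= n)%N, (N5 <= n)%N & (n0 <= n)%N].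
    by rewrite /k => kn; clearbody N4 N5; clear -kn; split; lia.
  have kb n : (k <= n)%N -> 2 <= b * n%:R.
    move=> /big2[_ h _ _]; rewrite mulrC -ler_pdivrMr //.
    by apply: le_trans (ltW (truncnS_gt _)) _; rewrite ler_nat.
  have kB n : (k <= n)%N -> 8 * B <= (d - c) * n%:R.
    move=> /big2[_ _ h _]; rewrite mulrC -[leRHS]mulrC -ler_pdivrMr ?subr_gt0 // [B * 8]mulrC.
    by apply: le_trans (ltW (truncnS_gt _)) _; rewrite ler_nat.
  have DP n : (k <= n)%N -> sup n = (D n)%:E /\ D n <= eps * (n%:R * psi n).
    by move=> /big2[h _ _ _]; exact: hN3.
  have kR n : (k <= n)%N -> 0 < n%:R :> R by move=> /big[_ h _ _ _]; rewrite ltr0n.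
  have npsi n : (k <= n)%N -> 0 < n%:R * psi n.
    by move=> /big[_ h _ _ _]; rewrite mulr_gt0 ?psi0 ?ltr0n.
  have npsi1 n : (k <= n)%N -> n%:R * psi n <= n%:R.
    move=> kn; have [_ h _ _ _] := big n kn; have /andP[_ p1] := psi1 n h.
    by rewrite ger_pMr ?kR // ltW.
  have hD1 n : (k <= n)%N -> D n * (2 * B + 1) <= psi n * n%:R.
    move=> kn; have [_ h] := DP n kn; have np := npsi n kn.
    have B21 : 0 <= 2 * B + 1 by clear -B0; lra.
    apply: le_trans (ler_wpM2r B21 h) _.
    have e3 : eps * (2 * B + 1) <= 1 by have := mulr_ge0 (ltW eps0) B0; clear -eps0 eps2; lra.
    by have := ler_wpM2r (ltW np) e3; clear; lra.
  have hD2 n : (k <= n)%N -> D n <= n%:R / 2.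
    move=> kn; have [_ h] := DP n kn; have np := npsi n kn; have np1 := npsi1 n kn.
    by have := ler_wpM2r (ltW np) eps4; have := kR n kn; clear -h np1; lra.
  have hD3 n : (k <= n)%N -> D n / psi n + 1 <= b * n%:R.
    move=> kn; have [_ h] := DP n kn; have [_ n1 _ _ _] := big n kn.
    have h1 : D n / psi n <= eps * n%:R by rewrite ler_pdivrMr ?psi0 // -mulrA.
    by have := kb n kn; have := ler_wpM2r (ltW (kR n kn)) eps1; clear -h1; lra.
  have Dm m n : (k <= m)%N -> (m <= n)%N -> D n <= D m.
    move=> km mn; have kn := leq_trans km mn.
    have [sm _] := DP m km; have [sn _] := DP n kn.
    have [_ _ _ n0m] := big2 m km.
    by have := hB2 m n n0m mn; rewrite -/(sup n) -/(sup m) sm sn lee_fin.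
  have k16 : (16 <= k)%N by rewrite /k; clearbody N4 N5; clear; lia.
  have cst0 : 0 < 504 * (1 + C) by clear -C0; lra.
  have [N [bT hT]] := @prime_sums_tail R psi D sup k (b / (504 * (1 + C))) b psi0 sup0
    (fun n kn => (DP n kn).1) A4 B3 (divr_gt0 b0 cst0) b0.
  have GP n : (k <= n)%N -> [/\ uniq (G n), kap * (b * n%:R) <= (size (G n))%:R &
      {in G n, forall m : int, c1 <= m%:~R / n%:R <= c1 + b}].
    move=> kn; have [_ _ _ h _] := big n kn; have [g1 g2 g3] := hG n h.
    by split => // m /g3[].
  have hT' : 504 * (1 + C) * (\sum_(k <= p < N | prime p) Num.max (psi p) (D p) * ln p%:R ^+ 2)
      <= b * (\sum_(k <= p < N | prime p) psi p) ^+ 2.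
    by rewrite mulrC -ler_pdivlMr // mulrAC.
  have bk1 : 1 <= b * k%:R by have := kb k (leqnn k); clear; lra.
  have phiL' n x y : (k <= n)%N -> J x -> J y -> `|phi n x - phi n y| <= D n * `|x - y|.
    by move=> kn; have [_ _ h _ _] := big n kn; exact: phiL.
  have b01 : 0 < b <= 1 by rewrite b0.
  have meas := @limsup_measure R psi D phi G J C B b c1 kap k N psi1 A2 psid C0 B0 b01
    kap0 k16 bk1 SJ phiB phiL' (fun n _ => D0 n) Dm hD1 hD2 hD3 GP bT hT'.
  set s := [seq _ | p <- _, m <- _] in meas.
  set W := \big[setU/set0]_(i <- s) _ in meas.
  have Wgood x : W x -> c <= x <= d /\ exists2 n, (k0 <= n)%N & good n x.
    rewrite /W -bigcup_seq => -[[n m] /= + xa].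
    case/allpairsPdep => n' [m' [hn' hm' [en em]]]; subst n' m'.
    move: hn'; rewrite mem_filter mem_index_iota => /andP[_ /andP[kn _]].
    have [k0n n1 _ N1n N2n] := big n kn.
    have [_ _ g3] := hG n N1n; have [m1 m2] := g3 m hm'.
    have [_ rL] := rhoP n N2n n1.
    have dcn : 2 <= (d - c) * n%:R.
      apply: le_trans (kb n kn) _; apply: ler_wpM2r; first exact: ltW (kR n kn).
      by rewrite /b; clear -cd; lra.
    have mI : c + (d - c) / 4 <= m%:~R / n%:R <= d - (d - c) / 4.
      by move: m1; rewrite /c1 /b; clear => /andP[? ?]; apply/andP; split; lra.
    rewrite /A /= in_itv in m2.
    have inJ y : c <= y <= d -> J y by move=> h; apply: cdJ; rewrite /= in_itv.
    have [x1 x2 x3] := @arc_good R psi phi rho n m c d B (D n) (L n) eta u v x n1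
      (psi1 n n1) B0 (D0 n) (L0 n) (fun y hy => phiB n y n1 (inJ y hy))
      (fun y z hy hz => phiL' n y z kn (inJ y hy) (inJ z hz))
      (fun y z => rhoL n y z N2n n1) (hD1 n kn) rL (kB n kn)
      dcn mI u0 v1 m2 xa.
    split => //; exists n => //; split => //.
    by apply: (I_conv u v).
  exists W; split.
  - by apply: bigsetU_measurable => i _; exact: measurable_itv.
  - by move=> x /Wgood[h _]; rewrite /= in_itv.
  - apply/seteqP; split => // x [/Wgood[_ [n kn gn]] [_ h]].
    exact: h gn.
  - apply: le_trans meas; rewrite lee_fin /kappa /b; clear; lra.
have loc k0 : (@lebesgue_measure R).-negligible
    [set theta | J theta /\ forall n, (k0 <= n)%N -> ~ good n theta].
  apply: (@lebesgue_null R _ J kappa kappa01 _ J_open) => [|x []//].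
  move=> c d cd cd1 cdJ; exact: sparse.
(* If the good n are finite in number, theta lies in the null set [loc] for k0 one above the largest
   of them. *)
rewrite /almost_everywhere; apply: negligibleS (negligible_bigcup loc).
move=> x /= /not_implyP[Jx /contrapT/finite_fsetP[X hX]].
exists (\max_(i <- X) i).+1 => //; split=> // n hn gn.
have : [set` X] n by rewrite -hX.
move=> /= nX; move: hn; rewrite ltnNge; case/negP.
exact: (leq_bigmax_seq _ nX).
Qed.
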